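(* Let $\Sigma$ be a topologically mixing topological Markov chain over a countable alphabet and $\widehat\mu$ an atomless local weak $\sigma$-Gibbs measure for a potential $\phi:\Sigma\to\mathbb R$ with $V_1(\phi)<\infty$; if the alphabet is infinite assume $\phi$ has summable variations and $P_G(\phi)<\infty$, and if it is finite assume $\phi$ continuous. Let $\widehat P$ be an $N$-cylinder for some $N$ and let $\{\ell_n\}\subset\mathbb N$; if the sequence $\{K_n\}$ of $\widehat\mu$ is unbounded assume $\limsup_n\ell_n/n<\infty$. Let $w$ be a $\widehat\mu$-hitting point with sequence $\{p_j\}$ such that $$\overline s:=\limsup_{n\to\infty}\frac1n\log\frac1{\widehat\mu(C(\ell_n,w))}<\infty .$$ Then $$\mathrm{Dim}_{\widehat\mu}(W_\sigma(\widehat P,\ell_n,w))\ge T^-,$$ where $T^-$ is the supremum (with $\sup\varnothing=0$) of the set of $0<t\le1$ such that $$\infty>P_G(t\phi)-P_G(\phi)t>\overline s\,t$$ and there exists a mixing local weak $\sigma$-Gibbs measure $\widehat m$ for the potential $t\phi$, with local constants satisfying $\sup\{c_{\widehat m}(w_{p_j}): j\in\mathbb N\}<\infty$, and with $\phi\in L^1(\widehat m)$.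
   Context: Markov chain: $\mathcal I$ alphabet, $A=(a_{i,j})$ an $\mathcal I\times\mathcal I$ matrix with entries in $\{0,1\}$, $\Sigma=\{(i_0,i_1,\dots): i_k\in\mathcal I,\ a_{i_k,i_{k+1}}=1\ \forall k\}$, metric $d((i_k),(j_k))=2^{-m}$, $m=\min\{n: i_n\ne j_n\}$, left shift $\sigma$. An $n$-cylinder is a nonempty set $C_{i_0\dots i_n}=\{k\in\Sigma: k_r=i_r,\ 0\le r\le n\}$; $C(n,w):=C_{w_0\dots w_n}$. Topologically mixing: for all $a,b\in\mathcal I$ there is $N(a,b)$ such that for all $n\ge N(a,b)$ some $w\in\Sigma$ has $w_0=a$, $w_n=b$. $V_n(\phi)=\sup\{|\phi(w)-\phi(w')|: w_k=w'_k,\ 0\le k\le n-1\}$; summable variations: $\sum_{n\ge2}V_n(\phi)<\infty$. Local weak Gibbs measure for $\phi$: a Borel probability $\widehat\mu$ for which there are a constant $P$, numbers $1\le K_n\le K_{n+1}$ with $\frac1n\log K_n\to0$ and constants $c(i)=c_{\widehat\mu}(i)\ge1$ ($i\in\mathcal I$; ''local constants'') such that for all $n\ge1$, all cylinders and $\widehat\mu$-a.e. $z\in C_{i_0\dots i_{n-1}}$, $\frac1{c(i_0)K_n}\le\widehat\mu(C_{i_0\dots i_{n-1}})/\exp(-nP+\sum_{j=0}^{n-1}\phi(\sigma^jz))\le c(i_0)K_n$. Local weak $\sigma$-Gibbs: in addition $\sigma$-invariant. Mixing: $\lim_n\widehat m(E\cap\sigma^{-n}F)=\widehat m(E)\widehat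 m(F)$ for Borel $E,F$. $w$ is a $\widehat\mu$-hitting point with sequence $\{p_j\}$ if $\{p_j\}\subset\mathbb N$ is increasing and $\sup_jc_{\widehat\mu}(w_{p_j})<\infty$. Gurevich pressure: $P_G(\phi)=\lim_n\frac1n\log\sum_{w_0=i,\,\sigma^nw=w}\exp\sum_{j=0}^{n-1}\phi(\sigma^jw)$ (independent of $i$); for finite alphabet it is the topological pressure $P_{top}(\phi)=\lim_n\frac1n\log\sum_C\exp[\sup_{z\in C}\sum_{j=0}^{n-1}\phi(\sigma^jz)]$, sum over all $n$-cylinders $C$. $W_\sigma(\widehat P,\ell_n,w)=\{z\in\widehat P:\ \sigma^k(z)\in C(\ell_k,w)\text{ for infinitely many }k\}$. For $E\subset\Sigma$, $M_\alpha(E)=\lim_{\varepsilon\to0}\inf\{\sum_i\widehat\mu(F_i)^\alpha: E\subset\bigcup_iF_i,\ F_i\text{ cylinders},\ \mathrm{diam}\,F_i\le\varepsilon\}$, and $\mathrm{Dim}_{\widehat\mu}(E)=\inf\{\alpha\geq 0: M_\alpha(E)=0\}$.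
   Formalization: Local weak Gibbs measures (both the given measure and those for tφ) are required to give every cylinder positive measure; read literally, the almost-everywhere bounds are vacuous on null cylinders and the claim fails. *)

(* Defs.v *)
From HB Require Import structures.
From mathcomp Require Import all_boot all_order all_algebra.
From mathcomp Require Import all_classical all_reals all_analysis.

Set Implicit Arguments.
Unset Strict Implicit.
Unset Printing Implicit Defensive.

Import Order.TTheory GRing.Theory Num.Theory.
Import numFieldNormedType.Exports.

Local Open Scope classical_set_scope.
Local Open Scope ring_scope.

Definition admissible (I : countType) (A : rel I) : set (nat -> I) :=
  [set w | forall k, A (w k) (w k.+1)].

(* The space Sigma of the topological Markov chain with transition matrix A.
   Non-emptiness is a parameter because measurable types must be pointed; R is
   a parameter because it is the field in which the metric takes its values. *)
Definition tmc (R : realType) (I : countType) (A : rel I)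
  (A0 : admissible A !=set0) : Type := set_type (admissible A).

Section Tmc.
Context {R : realType} {I : countType} {A : rel I} {A0 : admissible A !=set0}.
Local Notation Sigma := (tmc R A0).
Implicit Types w z : Sigma.

Definition tmc_val w : nat -> I := set_val w.

HB.instance Definition _ := Choice.on Sigma.

Definition mk_tmc (s : nat -> I) (adm_s : admissible A s) : Sigma :=
  exist (fun s => s \in admissible A) s (mem_set adm_s).

HB.instance Definition _ :=
  isPointed.Build Sigma (mk_tmc (projT2 (cid A0))).

Lemma tmc_admissible w k : A (tmc_val w k) (tmc_val w k.+1).
Proof. by case: w => /= w Hw; exact: (set_mem Hw). Qed.

Lemma tmc_inj w z : (forall n, tmc_val w n = tmc_val z n) -> w = z.
Proof. by move=> wz; apply: val_inj; apply/funext. Qed.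

Definition tmc_dist w z : R :=
  match pselect (exists n, tmc_val w n != tmc_val z n) with
  | left neq => 2 ^- ex_minn neq
  | right _ => 0
  end.

Lemma tmc_distP w z n :
  tmc_dist w z < 2 ^- n <->
  forall k, (k <= n)%N -> tmc_val w k = tmc_val z k.
Proof.
have half a b : (2 ^- a < 2 ^- b :> R) = (b < a)%N.
  by rewrite ltf_pV2 ?posrE ?exprn_gt0// ltr_eXn2l// ltr1n.
rewrite /tmc_dist; case: pselect => [neq|eqwz]; last first.
  split=> [_ k _|_]; last by rewrite invr_gt0 exprn_gt0.
  by apply/eqP/negPn/negP => wzk; apply: eqwz; exists k.
case: ex_minnP => m wzm mmin; rewrite half; split=> [nm k kn|wz].
  apply/eqP/negPn/negP => /mmin mk.
  by have := leq_trans nm (leq_trans mk kn); rewrite ltnn.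
by rewrite ltnNge; apply/negP => mn; move: wzm; rewrite wz ?eqxx.
Qed.

Lemma tmc_dist_cases w z :
  (w = z /\ tmc_dist w z = 0) \/ exists n, tmc_dist w z = 2 ^- n.
Proof.
rewrite /tmc_dist; case: pselect => [neq|eqwz]; last first.
  left; split=> //; apply: tmc_inj => k.
  by apply/eqP/negPn/negP => wzk; apply: eqwz; exists k.
by right; eexists.
Qed.

Lemma tmc_distxx w : tmc_dist w w = 0.
Proof.
by rewrite /tmc_dist; case: pselect => // neq; have [n] := neq; rewrite eqxx.
Qed.

Lemma tmc_dist_eq0 w z : tmc_dist w z = 0 -> w = z.
Proof.
case: (tmc_dist_cases w z) => [[]//|[n ->]] /eqP.
by rewrite invr_eq0 expf_eq0 pnatr_eq0 andbF.
Qed.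

Lemma tmc_dist_sym w z : tmc_dist w z = tmc_dist z w.
Proof.
have le u v : tmc_dist u v <= tmc_dist v u.
  have [[-> _]|[n nE]] := tmc_dist_cases u v; first exact: lexx.
  rewrite leNgt nE; apply/negP => /tmc_distP vu.
  suff : tmc_dist u v < 2 ^- n by rewrite nE ltxx.
  by apply/tmc_distP => k /vu.
by apply/eqP; rewrite eq_le !le.
Qed.

Lemma tmc_dist_triangle u w z :
  tmc_dist w z <= tmc_dist w u + tmc_dist u z.
Proof.
have ge0 x y : 0 <= tmc_dist x y.
  have [[_ ->]//|[n ->]] := tmc_dist_cases x y.
  by rewrite invr_ge0 exprn_ge0.
have [[_ ->]|[n nE]] := tmc_dist_cases w z; first exact: addr_ge0.
have [wu|wu] := ltP (tmc_dist w u) (2 ^- n); last first.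
  by rewrite nE (le_trans wu)// lerDl.
have [uz|uz] := ltP (tmc_dist u z) (2 ^- n); last first.
  by rewrite nE (le_trans uz)// lerDr.
suff : tmc_dist w z < 2 ^- n by rewrite nE ltxx.
move/tmc_distP : wu => wu; move/tmc_distP : uz => uz.
by apply/tmc_distP => k kn; rewrite wu// uz.
Qed.

HB.instance Definition _ := isMetric.Build R Sigma
  tmc_distxx tmc_dist_eq0 tmc_dist_sym tmc_dist_triangle.

HB.instance Definition _ :=
  Measurable.copy Sigma (g_sigma_algebraType (@open Sigma)).

Definition tmc_shift w : Sigma :=
  @mk_tmc (fun k => tmc_val w k.+1) (fun k => tmc_admissible w k.+1).

Definition topologically_mixing : Prop :=
  forall a b : I, exists N : nat, forall n, (N <= n)%N ->
    exists w : Sigma, tmc_val w 0 = a /\ tmc_val w n = b.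

(* C_{s_0 ... s_n}: n is the last index, so n.+1 symbols are prescribed. *)
Definition cylinder (n : nat) (s : nat -> I) : set Sigma :=
  [set z | forall r, (r <= n)%N -> tmc_val z r = s r].

Definition is_cylinder (n : nat) (C : set Sigma) : Prop :=
  C !=set0 /\ exists s, C = cylinder n s.

Definition nth_variation (phi : Sigma -> R) (n : nat) : \bar R :=
  ereal_sup [set y | exists w z,
    (forall k, (k < n)%N -> tmc_val w k = tmc_val z k) /\
    y = (`|phi w - phi z|)%:E].

Definition summable_variations (phi : Sigma -> R) : Prop :=
  (\sum_(2 <= n <oo) nth_variation phi n < +oo)%E.

Definition birkhoff_sum (phi : Sigma -> R) (n : nat) (z : Sigma) : R :=
  \sum_(j < n) phi (iter j tmc_shift z).

(* The common value of the limits for all i; the same formula is used for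
   finite and infinite alphabets. *)
Definition gurevich_pressure (phi : Sigma -> R) : \bar R :=
  get [set p : \bar R | forall i : I,
    (n%:R^-1%:E *
     lne (\esum_(w in [set w | tmc_val w 0 = i /\ iter n tmc_shift w = w])
            (expR (birkhoff_sum phi n w))%:E))%E @[n --> \oo] --> p].

(* The bounds are two-sided estimates on the measure of every cylinder, so every
   cylinder has positive measure; this must be said, as otherwise the almost
   everywhere clause would be vacuous on null cylinders. *)
Definition local_weak_gibbs (phi : Sigma -> R) (mu : probability Sigma R)
    (P : R) (K : R^nat) (c : I -> R) : Prop :=
  [/\ forall n, (0 < n)%N -> 1 <= K n <= K n.+1,
      ln (K n) / n%:R @[n --> \oo] --> 0,
      forall i, 1 <= c i &
      forall (n : nat) (s : nat -> I), cylinder n s !=set0 ->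
        (0 < mu (cylinder n s))%E /\
        {ae mu, forall z, cylinder n s z ->
          (c (s 0) * K n.+1)^-1 <=
          fine (mu (cylinder n s)) /
            expR (- (n.+1%:R * P) + birkhoff_sum phi n.+1 z)
          <= c (s 0) * K n.+1}].

Definition shift_invariant (mu : probability Sigma R) : Prop :=
  forall E : set Sigma, measurable E -> mu (tmc_shift @^-1` E) = mu E.

Definition local_weak_sigma_gibbs (phi : Sigma -> R)
    (mu : probability Sigma R) (P : R) (K : R^nat) (c : I -> R) : Prop :=
  local_weak_gibbs phi mu P K c /\ shift_invariant mu.

Definition mixing (m : probability Sigma R) : Prop :=
  forall E F : set Sigma, measurable E -> measurable F ->
    m (E `&` iter n tmc_shift @^-1` F) @[n --> \oo] --> (m E * m F)%E.

Definition atomless (mu : probability Sigma R) : Prop :=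
  forall E : set Sigma, measurable E -> (0 < mu E)%E ->
    exists F, [/\ measurable F, F `<=` E & (0 < mu F < mu E)%E].

Definition hitting_point (c : I -> R) (w : Sigma) (p : nat -> nat) : Prop :=
  (forall j, (p j < p j.+1)%N) /\
  has_ubound (range (fun j => c (tmc_val w (p j)))).

Definition W_shift (Phat : set Sigma) (l : nat -> nat) (w : Sigma) :
    set Sigma :=
  [set z | Phat z /\
    infinite_set [set k | cylinder (l k) (tmc_val w) (iter k tmc_shift z)]].

Definition diam (F : set Sigma) : \bar R :=
  ereal_sup [set y | exists z z', [/\ F z, F z' & y = (mdist z z')%:E]].

(* Covers are finite or countable families, indexed by a subset J of nat. *)
Definition cylinder_premeasure (mu : probability Sigma R) (alpha : R)
    (E : set Sigma) (e : R) : \bar R :=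
  ereal_inf [set v | exists (J : set nat) (F : nat -> set Sigma),
    [/\ E `<=` \bigcup_(i in J) F i,
        forall i, J i ->
          (exists n, is_cylinder n (F i)) /\ (diam (F i) <= e%:E)%E &
        v = (\esum_(i in J) (mu (F i) `^ alpha))%E]].

Definition M_alpha (mu : probability Sigma R) (alpha : R) (E : set Sigma) :
    \bar R :=
  lim (cylinder_premeasure mu alpha E e @[e --> 0^'+]).

Definition Dim (mu : probability Sigma R) (E : set Sigma) : \bar R :=
  ereal_inf [set alpha%:E | alpha in
    [set alpha : R | 0 <= alpha /\ M_alpha mu alpha E = 0%E]].

End Tmc.

Arguments topologically_mixing R {I A} A0.

(* Main.v *)
Require Import Defs.
From mathcomp Require Import all_boot all_order all_algebra.
From mathcomp Require Import all_classical all_reals all_analysis.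
From mathcomp Require Import measurable_realfun ring lra.
Import Order.TTheory GRing.Theory Num.Theory.
Import numFieldNormedType.Exports.
Local Open Scope classical_set_scope.
Local Open Scope ring_scope.

(* Since phi is continuous, the Gibbs inequalities hold at every point, and
   counting periodic orbits through cylinders gives P_G(phi) = P and
   P_G(t phi) = Pm.  Hence m(C) is comparable to mu(C)^t exp(-n (Pm - t P)) for
   cylinders C of length n, and Pm - t P > s t for some s > sbar.  Choose times k
   and hitting times p_j >= l_k with mu(C(p_j, w)) >= exp(-k s), and, in a cylinder
   ending with a symbol w_(p_i), the points whose shift by k lies in C(p_j, w):
   these subcylinders J' are spread according to m up to time k, and satisfy
   mu(J')^t >= m(C(k, z)) exp(k (Pm - t P - s t)) up to subexponential factors, so
   distributing mass along m keeps the mass of every cylinder F below mu(F)^t.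
   The limit measure is not constructed: given a cover of small total weight,
   averaging over the children of a cylinder finds one in which the weight of
   the cover is still below the mass of the child, and the intersection of such
   a nested sequence is an uncovered point of W. *)

(** * Agreement of prefixes, measurability, splicing of sequences and Birkhoff sums *)

Section Shift.
Set Implicit Arguments.
Unset Strict Implicit.
Context {R : realType} {I : countType} {A : rel I}
  {A0 : admissible A !=set0}.
Local Notation Sigma := (tmc R A0).
Implicit Types x y z : Sigma.

Lemma tmc_val_mk s (adm : admissible A s) n :
  tmc_val (mk_tmc adm : Sigma) n = s n.
Proof. by []. Qed.

Lemma tmc_val_shift z n : tmc_val (tmc_shift z) n = tmc_val z n.+1.
Proof. by []. Qed.

Lemma tmc_val_iter k z n :
  tmc_val (iter k (@tmc_shift R I A A0) z) n = tmc_val z (k + n).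
Proof. by elim: k z n => // k IH z n; rewrite iterS tmc_val_shift IH addnS. Qed.

Definition agree n x y := forall r, (r <= n)%N -> tmc_val x r = tmc_val y r.

Lemma agree_sym n x y : agree n x y -> agree n y x.
Proof. by move=> h r rn; rewrite h. Qed.

Lemma agree_trans n x y z : agree n x y -> agree n y z -> agree n x z.
Proof. by move=> h k r rn; rewrite h ?k. Qed.

Lemma agree_le m n x y : (m <= n)%N -> agree n x y -> agree m x y.
Proof. by move=> mn h r rm; apply: h; exact: leq_trans mn. Qed.

Lemma agree_shift k n x y : agree (k + n) x y ->
  agree n (iter k (@tmc_shift _ _ _ _) x) (iter k (@tmc_shift _ _ _ _) y).
Proof. by move=> h r rn; rewrite !tmc_val_iter h// leq_add2l. Qed.

Lemma open_agree n (E : set Sigma) :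
  (forall x y, agree n x y -> E x -> E y) -> open E.
Proof.
move=> h; rewrite openE => x Ex; apply/nbhs_ballP; exists (2 ^- n) => /=.
  by rewrite invr_gt0 exprn_gt0.
move=> y; rewrite -metricType_numDomainType.ball_mdistE /= => /tmc_distP xy.
exact: h Ex.
Qed.

Lemma measurable_agree n (E : set Sigma) :
  (forall x y, agree n x y -> E x -> E y) -> measurable E.
Proof. by move=> /open_agree oE; exact: sub_sigma_algebra. Qed.

Lemma measurable_cylinder n s : measurable (cylinder n s : set Sigma).
Proof.
by apply: (@measurable_agree n) => x y xy h r rn; rewrite -xy ?h.
Qed.

(** The shift is continuous: agreement up to [n.+1] becomes agreement up to [n], so preimages of
    open sets are open. *)
Lemma measurable_iter_shift k : measurable_fun setT (iter k (@tmc_shift R I A A0)).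
Proof.
suff H : measurable_fun setT (@tmc_shift R I A A0).
  elim: k => [|k IH]; first exact: measurable_id.
  have -> : iter k.+1 (@tmc_shift R I A A0) =
    @tmc_shift R I A A0 \o iter k (@tmc_shift R I A A0) by [].
  exact: measurableT_comp.
apply: (@measurability _ _ _ _ _ _ (@open Sigma)) => //.
move=> _ [E oE <-]; rewrite setTI; apply: sub_sigma_algebra => /=.
rewrite openE => x Ex.
move: oE; rewrite openE => /(_ _ Ex) /nbhs_ballP[e /= e0 he].
have [n ne] : exists n, (2 ^- n : R) < e.
  have [n hn] := @ltr_add_invr R 0 e e0; rewrite add0r in hn.
  exists n; apply: le_lt_trans hn; rewrite lef_pV2 ?posrE ?exprn_gt0 ?ltr0n//.
  by rewrite -natrX ler_nat ltn_expl.
apply/nbhs_ballP; exists (2 ^- n.+1) => /=; first by rewrite invr_gt0 exprn_gt0.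
move=> y; rewrite -metricType_numDomainType.ball_mdistE /= => /tmc_distP xy.
apply: he; rewrite -metricType_numDomainType.ball_mdistE /=.
apply: lt_trans ne; apply/tmc_distP => r rn; exact: xy.
Qed.

Definition splice_val L x z (n : nat) : I :=
  if (n < L)%N then tmc_val x n else tmc_val z (n - L).

Lemma splice_admissible L x z : tmc_val z 0 = tmc_val x L ->
  admissible A (splice_val L x z).
Proof.
move=> xz n; rewrite /splice_val; case: ltnP => nL; case: ltnP => nL'.
- exact: tmc_admissible.
- have -> : L = n.+1 by apply/eqP; rewrite eqn_leq nL nL'.
  rewrite subnn xz; have -> : L = n.+1 by apply/eqP; rewrite eqn_leq nL nL'.
  exact: tmc_admissible.
- by move: (leq_trans nL' nL); rewrite ltnNge leqnSn.
- rewrite subSn//; exact: tmc_admissible.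
Qed.

(** The symbol at position [L] is shared by both pieces. If they do not match there, the value
    defaults to [x]. *)
Definition splice L x z : Sigma :=
  match pselect (tmc_val z 0 = tmc_val x L) with
  | left h => mk_tmc (splice_admissible h)
  | right _ => x
  end.

Lemma tmc_val_splice L x z n : tmc_val z 0 = tmc_val x L ->
  tmc_val (splice L x z) n = if (n < L)%N then tmc_val x n else tmc_val z (n - L).
Proof. by rewrite /splice => xz; case: pselect. Qed.

Lemma agree_splice L x z : tmc_val z 0 = tmc_val x L -> agree L (splice L x z) x.
Proof.
move=> xz n; rewrite leq_eqVlt tmc_val_splice// => /predU1P[->|->//].
by rewrite ltnn subnn.
Qed.

Lemma shift_splice L x z : tmc_val z 0 = tmc_val x L ->
  iter L (@tmc_shift _ _ _ _) (splice L x z) = z.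
Proof.
move=> xz; apply: tmc_inj => n.
by rewrite tmc_val_iter tmc_val_splice// ltnNge leq_addr addKn.
Qed.

Lemma birkhoff_sumD (phi : Sigma -> R) m n z :
  birkhoff_sum phi (m + n) z =
  birkhoff_sum phi m z + birkhoff_sum phi n (iter m (@tmc_shift _ _ _ _) z).
Proof.
rewrite /birkhoff_sum big_split_ord /=; congr (_ + _).
by apply: eq_bigr => i _; rewrite addnC iterD.
Qed.

Lemma birkhoff_sum1 (phi : Sigma -> R) z : birkhoff_sum phi 1 z = phi z.
Proof. by rewrite /birkhoff_sum big_ord1. Qed.

Lemma birkhoff_sumZ (phi : Sigma -> R) t n z :
  birkhoff_sum (fun z => t * phi z) n z = t * birkhoff_sum phi n z.
Proof. by rewrite /birkhoff_sum mulr_sumr. Qed.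

End Shift.

(** * The Gibbs inequalities at every point *)

Section Gibbs.
Set Implicit Arguments.
Unset Strict Implicit.
Context {R : realType} {I : countType} {A : rel I}
  {A0 : admissible A !=set0}.
Local Notation Sigma := (tmc R A0).
Implicit Types (x y z : Sigma) (phi : Sigma -> R) (mu : probability Sigma R).

Definition cylm mu n z : R := fine (mu (cylinder n (tmc_val z))).

Lemma cylinder_agree n x y : agree n x y ->
  cylinder n (tmc_val x) = cylinder n (tmc_val y) :> set Sigma.
Proof.
move=> xy; apply/seteqP; split => z h r rn; rewrite h//; first exact: xy.
by rewrite xy.
Qed.

Lemma cylmE mu n z : mu (cylinder n (tmc_val z)) = (cylm mu n z)%:E.
Proof. by rewrite fineK// fin_num_measure//; exact: measurable_cylinder. Qed.

Lemma cylm_agree mu n x y : agree n x y -> cylm mu n x = cylm mu n y.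
Proof. by rewrite /cylm => /cylinder_agree ->. Qed.

Lemma cylm_le mu m n z : (m <= n)%N -> cylm mu n z <= cylm mu m z.
Proof.
move=> mn; rewrite -lee_fin -!cylmE; apply: le_measure.
- by rewrite inE; exact: measurable_cylinder.
- by rewrite inE; exact: measurable_cylinder.
- by move=> y h r rm; apply: h; exact: leq_trans mn.
Qed.

Lemma cylm_le1 mu n z : cylm mu n z <= 1.
Proof. by rewrite -lee_fin -cylmE; exact: probability_le1 (measurable_cylinder _ _). Qed.

(** The common form of the regularity assumptions: continuity for a finite alphabet and summable
    variations for an infinite one both give it. *)
Definition cyl_continuous phi := forall y e, 0 < e ->
  exists M, forall y', agree M y y' -> `|phi y - phi y'| < e.

Lemma continuous_cyl_continuous phi : continuous phi -> cyl_continuous phi.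
Proof.
move=> cphi y e e0.
have /cvgrPdist_lt /(_ e e0) := cphi y.
move=> /nbhs_ballP[d /= d0 hd].
have [n hn] := @ltr_add_invr R 0 d d0; rewrite add0r in hn.
exists n => y' yy'; apply: hd.
rewrite -metricType_numDomainType.ball_mdistE /=; apply: lt_trans hn.
apply: (@lt_le_trans _ _ (2 ^- n)); first exact/tmc_distP.
by rewrite lef_pV2 ?posrE ?exprn_gt0 ?ltr0n// -natrX ler_nat ltn_expl.
Qed.

(** If every variation were at least [e], the partial sums would exceed any bound; so some variation
    is below [e], and it controls the oscillation on a cylinder. *)
Lemma summable_variations_cyl_continuous phi :
  summable_variations phi -> cyl_continuous phi.
Proof.
move=> sv y e e0.
have V0 n : (0 <= nth_variation phi n)%E.
  apply: ereal_sup_ubound; exists y, y; split=> //.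
  by rewrite subrr normr0.
suff [n hn] : exists n, (nth_variation phi n < e%:E)%E.
  exists n => y' yy'; rewrite -lte_fin; apply: le_lt_trans hn.
  apply: ereal_sup_ubound; exists y, y'; split=> // k kn.
  by apply: yy'; exact: ltnW.
apply: contrapT => /forallNP h.
have he n : (e%:E <= nth_variation phi n)%E by rewrite leNgt; apply/negP.
set S := (\sum_(2 <= n <oo) nth_variation phi n)%E in sv.
have S0 : (0 <= S)%E by apply: nneseries_ge0.
have SE : S = (fine S)%:E by rewrite fineK// ge0_fin_numE.
have hS n : (n%:R * e <= fine S).
  rewrite -lee_fin -SE.
  apply: (@le_trans _ _ (\sum_(2 <= i < n.+2) nth_variation phi i)%E); last first.
    exact: (@nneseries_lim_ge _ (nth_variation phi) xpredT 2 n.+2).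
  apply: (@le_trans _ _ (\sum_(2 <= i < n.+2) e%:E)%E).
    by rewrite sumEFin lee_fin sumr_const_nat subn2 /= mulr_natl.
  by apply: lee_sum => i _.
have := archi_boundP (divr_ge0 (fine_ge0 S0) (ltW e0)).
by rewrite ltr_pdivrMr// ltNge hS.
Qed.

Lemma birkhoff_cyl_continuous phi n :
  cyl_continuous phi -> cyl_continuous (birkhoff_sum phi n).
Proof.
move=> cphi; elim: n => [|n IH] y e e0.
  by exists 0%N => y' _; rewrite /birkhoff_sum !big_ord0 subrr normr0.
have e2 : 0 < e / 2 by rewrite divr_gt0.
have [M hM] := IH y _ e2.
have [M' hM'] := cphi (iter n (@tmc_shift _ _ _ _) y) _ e2.
exists (maxn M (n + M')) => y' yy'.
rewrite -addn1 !birkhoff_sumD !birkhoff_sum1 opprD addrACA.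
have := hM y' (agree_le (leq_maxl _ _) yy').
have := hM' _ (agree_shift (agree_le (leq_maxr _ _) yy')).
set a := _ - _; set b := _ - _ => ha hb.
have := ler_normD b a; lra.
Qed.

Lemma ae_meets mu (E : set Sigma) (Q : set Sigma) :
  measurable E -> (0 < mu E)%E -> {ae mu, forall z, Q z} -> exists2 z, E z & Q z.
Proof.
move=> mE E0 [N [mN N0 hN]]; apply: contrapT => h.
suff : (mu E <= 0)%E by rewrite leNgt E0.
rewrite -N0; apply: le_measure; rewrite ?inE// => z Ez.
by apply: hN => Qz; apply: h; exists z.
Qed.

Definition log_gibbs phi mu (P : R) (K : R^nat) (c : I -> R) :=
  forall n y, 0 < cylm mu n y /\
    `|ln (cylm mu n y) + n.+1%:R * P - birkhoff_sum phi n.+1 y|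
      <= ln (c (tmc_val y 0)) + ln (K n.+1).

(** Small cylinders around [y] have positive measure, so they contain points where the almost
    everywhere bound holds and whose Birkhoff sum is within [e] of that of [y]; [e] is arbitrary. *)
Lemma local_weak_gibbs_log phi mu P K c :
  cyl_continuous phi -> local_weak_gibbs phi mu P K c -> log_gibbs phi mu P K c.
Proof.
move=> cphi [K1 _ c1 hG] n y.
have ne : (cylinder n (tmc_val y) : set Sigma) !=set0 by exists y.
have [mu0 ae] := hG _ _ ne.
have X0 : 0 < cylm mu n y by rewrite -lte_fin -cylmE.
have K0 : 0 < K n.+1 by have /andP[K1n _] := K1 n.+1 isT; exact: lt_le_trans K1n.
have c0 : 0 < c (tmc_val y 0) by exact: lt_le_trans (c1 _).
split=> //; apply/ler_addgt0Pr => e e0.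
have [M hM] := birkhoff_cyl_continuous n.+1 cphi y e0.
(* Deep enough both to control the Birkhoff sum and to stay in the cylinder of index [n]. *)
set M' := maxn M n.
have ne' : (cylinder M' (tmc_val y) : set Sigma) !=set0 by exists y.
have [mu0' _] := hG _ _ ne'.
have [z yz hz] := ae_meets (measurable_cylinder _ _) mu0' ae.
have {}hz : (c (tmc_val y 0) * K n.+1)^-1 <=
    cylm mu n y / expR (- (n.+1%:R * P) + birkhoff_sum phi n.+1 z) <=
    c (tmc_val y 0) * K n.+1.
  by apply: hz => r rn; rewrite yz// (leq_trans rn)// leq_maxr.
have {}hM : `|birkhoff_sum phi n.+1 y - birkhoff_sum phi n.+1 z| < e.
  by apply: hM => r rM; rewrite yz// (leq_trans rM)// leq_maxl.
set E := - _ + _ in hz.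
have E0 := expR_gt0 E.
have hl : `|ln (cylm mu n y) - E| <= ln (c (tmc_val y 0)) + ln (K n.+1).
  have lnE : ln (cylm mu n y / expR E) = ln (cylm mu n y) - E.
    by rewrite ln_div ?posrE// expRK.
  move: hz => /andP[h1 h2].
  rewrite -lnM ?posrE// -lnE ler_norml; apply/andP; split.
    by rewrite -lnV ?posrE ?mulr_gt0// ler_ln ?posrE ?invr_gt0 ?mulr_gt0 ?invr_gt0.
  by rewrite ler_ln ?posrE ?mulr_gt0 ?invr_gt0.
have -> : ln (cylm mu n y) + n.+1%:R * P - birkhoff_sum phi n.+1 y =
  (ln (cylm mu n y) - E) - (birkhoff_sum phi n.+1 y - birkhoff_sum phi n.+1 z).
  by rewrite /E; ring.
by apply: le_trans (ler_normB _ _) _; apply: lerD => //; exact: ltW.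
Qed.

End Gibbs.

(** * Sums and subadditivity over countable index sets *)

Section CountableSums.
Set Implicit Arguments.
Unset Strict Implicit.
Local Open Scope ereal_scope.

Lemma esumZ_le (R : realType) (T : choiceType) (D : set T) (k : R)
    (a : T -> \bar R) : (0 <= k)%R -> (forall i, 0 <= a i) ->
  \esum_(i in D) (k%:E * a i) <= k%:E * \esum_(i in D) a i.
Proof.
move=> k0 a0; apply: ge_ereal_sup => _ [X hX <-].
rewrite -ge0_mule_fsumr//; apply: lee_wpmul2l; first by rewrite lee_fin.
by apply: ereal_sup_ubound; exists X.
Qed.

(** An injection [f] of [D] into [nat] reduces this to sequences: the union over a fibre of [f] is a
    single [F i] or empty. *)
Lemma measure_countable_subadditive d (T : measurableType d) (R : realType)
    (mu : measure T R) (J : choiceType) (D : set J) (F : J -> set T) :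
  countable D -> (forall i, measurable (F i)) ->
  mu (\bigcup_(i in D) F i) <= \esum_(i in D) mu (F i).
Proof.
move=> /countable_injP[f finj] mF.
have hU : \bigcup_(i in D) F i =
    \bigcup_n \bigcup_(i in D `&` f @^-1` [set n]) F i.
  apply/seteqP; split=> [x [i Di Fix]|x [n _ [i [Di _] Fix]]]; last by exists i.
  by exists (f i) => //; exists i.
have fE n i : D i -> f i = n ->
    \bigcup_(i in D `&` f @^-1` [set n]) F i = F i.
  move=> Di fi; apply/seteqP; split=> x.
    move=> [j [Dj fj] Fjx]; suff -> : i = j by [].
    by apply: finj; rewrite ?inE// fi fj.
  by move=> Fix; exists i.
have mG n : measurable (\bigcup_(i in D `&` f @^-1` [set n]) F i).
  have [[i [Di fi]]|h] := pselect (exists i, D i /\ f i = n).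
    by rewrite (fE _ i).
  rewrite (_ : \bigcup_(i in _) _ = set0)//.
  by apply/seteqP; split => x // [i [Di fi] _]; apply: h; exists i.
rewrite hU.
apply: (le_trans
  (@measure_sigma_subadditive _ _ _ mu _ _ mG _ (@subset_refl _ _))).
  exact: bigcup_measurable.
rewrite nneseries_esumT//.
rewrite (esumID (f @` D))//.
rewrite [X in _ + X]esum1 ?adde0; last first.
  move=> n [_ /= h]; rewrite (_ : \bigcup_(i in _) _ = set0) ?measure0//.
  by apply/seteqP; split => x // [i [Di fi] _]; apply: h; exists i.
rewrite setTI esum_image.
  by rewrite le_esum// => i Di; rewrite (fE _ i).
exact: finj.
Qed.

End CountableSums.

(** * Periodic points and invariant measures *)

Section Pressure.
Set Implicit Arguments.
Unset Strict Implicit.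
Context {R : realType} {I : countType} {A : rel I}
  {A0 : admissible A !=set0}.
Local Notation Sigma := (tmc R A0).
Local Notation shift := (@tmc_shift R I A A0).
Implicit Types (x y z : Sigma) (phi : Sigma -> R) (mu : probability Sigma R).

Definition periodic n (i : I) : set Sigma :=
  [set w | tmc_val w 0 = i /\ iter n shift w = w].

Lemma periodic_val n i z r : periodic n i z -> tmc_val z (n + r) = tmc_val z r.
Proof. by move=> [_ h]; rewrite -tmc_val_iter h. Qed.

Lemma periodic_val_mod n i z r : periodic n i z ->
  tmc_val z r = tmc_val z (r %% n)%N.
Proof.
move=> h; rewrite {1}(divn_eq r n); elim: (r %/ n)%N => // q IH.
by rewrite mulSn -addnA (periodic_val _ h).
Qed.

Lemma periodic_inj n i x y : periodic n.+1 i x -> periodic n.+1 i y ->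
  agree n x y -> x = y.
Proof.
move=> hx hy xy; apply: tmc_inj => r.
by rewrite (periodic_val_mod r hx) (periodic_val_mod r hy) xy// -ltnS ltn_pmod.
Qed.

Lemma countable_periodic n i : countable (periodic n.+1 i).
Proof.
apply/countable_injP; exists (fun z => pickle (mkseq (tmc_val z) n.+1)).
move=> x y; rewrite !inE => hx hy /(pcan_inj pickleK) xy.
apply: (periodic_inj hx hy) => r rn.
have := congr1 (fun s => nth (tmc_val x 0) s r) xy.
by rewrite !nth_mkseq.
Qed.

(** The word of the first [n] symbols of [u] can be repeated forever, because the symbol after it is
    its own first symbol. *)
Lemma periodic_close n u i : (0 < n)%N -> tmc_val u 0 = i -> tmc_val u n = i ->
  exists2 w, periodic n i w & agree n w u.
Proof.
move=> n0 u0 un.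
have adm : admissible A (fun r => tmc_val u (r %% n)%N).
  move=> r; have -> : (r.+1 %% n = (r %% n).+1 %% n)%N.
    by rewrite -[in RHS]addn1 modnDml addn1.
  have := tmc_admissible u (r %% n)%N.
  have := ltn_pmod r n0; rewrite leq_eqVlt => /predU1P[->|h].
    by rewrite modnn un u0.
  by rewrite (modn_small h).
exists (mk_tmc adm : Sigma).
  split; first by rewrite tmc_val_mk mod0n.
  by apply: tmc_inj => r; rewrite tmc_val_iter !tmc_val_mk modnDl.
move=> r; rewrite leq_eqVlt tmc_val_mk => /predU1P[->|rn].
  by rewrite modnn un u0.
by rewrite modn_small.
Qed.

Lemma shift_invariant_iter mu n (E : set Sigma) : shift_invariant mu ->
  measurable E -> mu (iter n shift @^-1` E) = mu E.
Proof.
move=> inv mE; elim: n => // n IH.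
rewrite -[RHS]IH -[RHS]inv.
  by congr (mu _); apply/seteqP; split => z /=; rewrite -iterSr.
by rewrite -[X in measurable X]setTI; exact: measurable_iter_shift.
Qed.

Lemma probability_capI_ge mu (E F : set Sigma) : measurable E -> measurable F ->
  fine (mu E) + fine (mu F) - 1 <= fine (mu (E `&` F)).
Proof.
move=> mE mF.
have mEF : measurable (E `&` F) by exact: measurableI.
rewrite lerBlDr -lee_fin !EFinD !fineK ?fin_num_measure//.
have -> : 1%E = (mu F + mu (~` F))%E :> \bar R.
  by rewrite probability_setC// addeC subeK// fin_num_measure.
rewrite [leRHS]addeCA [leLHS]addeC; apply: leeD => //.
have -> : mu E = mu ((E `&` F) `|` (E `&` ~` F)) by rewrite -setIUr setUv setIT.
have mEC : measurable (E `&` ~` F) by apply: measurableI => //; exact: measurableC.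
apply: le_trans (measureU2 _ mEF mEC) _; apply: leeD => //.
by apply: le_measure; rewrite ?inE//; exact: measurableC.
Qed.

End Pressure.

(** * The Gibbs constant is the Gurevich pressure *)

Section GurevichPressure.
Set Implicit Arguments.
Unset Strict Implicit.
Context {R : realType} {I : countType} {A : rel I}
  {A0 : admissible A !=set0}.
Local Notation Sigma := (tmc R A0).
Local Notation shift := (@tmc_shift R I A A0).
Implicit Types (x y z : Sigma).
Variables (phi : Sigma -> R) (mu : probability Sigma R) (P : R) (K : R^nat)
  (c : I -> R).
Hypothesis G : log_gibbs phi mu P K c.

(** Each term is at most a constant times the measure of the cylinder of index [n] around the
    periodic point; these cylinders are disjoint, so their measures add up to at most 1. *)
Lemma periodic_sum_le n i :
  (\esum_(w in periodic n.+1 i) (expR (birkhoff_sum phi n.+1 w))%:E <=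
   (expR (n.+1%:R * P + ln (c i) + ln (K n.+1)))%:E)%E.
Proof.
apply: ge_ereal_sup => _ [X [finX XP] <-].
set C := expR _.
apply: (@le_trans _ _ (\sum_(w \in X) (C%:E * mu (cylinder n (tmc_val w))))%E).
  apply: lee_fsum => // w /XP hw; rewrite cylmE -EFinM lee_fin.
  have [X0] := G n w; rewrite hw.1 => /ler_normlP[h _].
  by rewrite -[cylm _ _ _]lnK// /C -expRD ler_expR; lra.
rewrite -ge0_mule_fsumr// -measure_fin_bigcup//; last 2 first.
- move=> w w' /XP hw /XP hw' [z [zw zw']]; apply: (periodic_inj hw hw').
  by move=> r rn; rewrite -zw ?zw'.
- by move=> *; exact: measurable_cylinder.
rewrite -[leRHS]mule1; apply: lee_wpmul2l; first by rewrite lee_fin expR_ge0.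
apply: probability_le1; apply: fin_bigcup_measurable => // *.
exact: measurable_cylinder.
Qed.

Hypothesis mixA : topologically_mixing R A0.

(** Only finitely many symbols [b] have code at most [k], so mixing gives one length [N] for all of
    them. The Gibbs inequality bounds the Birkhoff sum on each chosen word from below. *)
Lemma connecting_words k i : exists N D, (0 < N)%N /\
  forall b, (pickle b <= k)%N -> exists2 y : Sigma,
    tmc_val y 0 = b /\ tmc_val y N = i &
    forall z, agree N.-1 y z -> - D <= birkhoff_sum phi N z.
Proof.
have [f hf] := choice (fun b => mixA b i).
(* Codes of no symbol count as 0, and the successor makes [N] positive. *)
pose N := (\max_(j < k.+1) oapp f 0 (unpickle j)).+1.
have /choice[y hy] : forall b, exists y : Sigma, (f b <= N)%N ->
    tmc_val y 0 = b /\ tmc_val y N = i.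
  move=> b; have [bN|bN] := leqP (f b) N; last by exists point.
  by have [y hy] := hf b N bN; exists y.
pose v b := ln (cylm mu N.-1 (y b)) + N%:R * P - ln (c b) - ln (K N).
exists N, (\sum_(j < k.+1) oapp (fun b => `|v b|) 0 (unpickle j)).
split=> // b bk; have bk' : (pickle b < k.+1)%N by [].
have fbN : (f b <= N)%N.
  apply: leqW; have := @leq_bigmax _ (fun j : 'I_k.+1 => oapp f 0%N (unpickle j))
    (Ordinal bk').
  by rewrite /= pickleK.
have [yb0 ybN] := hy b fbN.
exists (y b) => // z hz.
have := (G N.-1 z).2; rewrite -(cylm_agree mu hz) -(hz 0%N)// yb0.
rewrite (_ : N.-1.+1 = N)// => /ler_normlP[_ h].
apply: (@le_trans _ _ (v b)); last by rewrite /v; lra.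
apply: (@le_trans _ _ (- `|v b|)).
  rewrite lerN2 (bigD1 (Ordinal bk'))//= pickleK/= lerDl.
  by apply: sumr_ge0 => j _; case: unpickle => //=.
by rewrite lerNl -normrN ler_norm.
Qed.

Hypothesis inv : shift_invariant mu.

Lemma probability_symbols (e : R) : 0 < e ->
  exists k, 1 - e < fine (mu [set z | (pickle (tmc_val z 0%N) <= k)%N]).
Proof.
move=> e0; pose S k := [set z : Sigma | (pickle (tmc_val z 0%N) <= k)%N].
have mS k : measurable (S k).
  by apply: (@measurable_agree _ _ _ _ 0%N) => x y xy; rewrite /S /= (xy 0%N).
have UT : \bigcup_k S k = setT.
  by apply/seteqP; split => // z _; exists (pickle (tmc_val z 0%N)) => //; rewrite /S /= leqnn.
have h : (mu \o S) x @[x --> \oo] --> (1:R)%:E.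
  rewrite -(@probability_setT _ _ _ mu) -UT; apply: nondecreasing_cvg_mu => //.
    by rewrite UT.
  by move=> m n mn; apply/subsetPset => z /= zm; exact: leq_trans mn.
have /fine_cvgP[_ /cvgrPdist_lt /(_ _ e0)[k _ hk]] := h.
exists k; have := hk k (leqnn k) => /ltr_normlP[/= _]; rewrite -/(S k).
lra.
Qed.

(** Orbits that start at [i] and are at time [q] in one of finitely many symbols have measure
    bounded below, uniformly in [q]. Each is closed up to period [q + N] by a connecting word, so
    the cylinders of index [q] around the resulting periodic points cover this set. *)
Lemma periodic_sum_ge i : exists N D, (0 < N)%N /\ forall q, (0 < q)%N ->
  ((expR (q%:R * P - ln (K q) - D))%:E <=
   \esum_(w in periodic (q + N) i) (expR (birkhoff_sum phi (q + N) w))%:E)%E.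
Proof.
have [x0 x0i] : exists x : Sigma, tmc_val x 0 = i.
  by have [n /(_ n (leqnn n))[x [xi _]]] := mixA i i; exists x.
set a := cylm mu 0 x0.
have a0 : 0 < a by have [] := G 0 x0.
(* The excluded symbols have mass below [a / 2]; by invariance this also holds at time [q], so at
   least half of the mass [a] of the symbol [i] remains. *)
have [k hk] : exists k, 1 - a / 2 < fine (mu [set z | (pickle (tmc_val z 0%N) <= k)%N]).
  by apply: probability_symbols; rewrite divr_gt0.
pose F := [set z : Sigma | (pickle (tmc_val z 0%N) <= k)%N]; rewrite -/F in hk.
have mF : measurable F.
  apply: (@measurable_agree _ _ _ _ 0%N) => x y xy; rewrite /F /=.
  by rewrite (xy 0%N).
have [N [D [N0 hND]]] := connecting_words k i.
exists N, (D + ln (c i) - ln (a / 2)); split=> // q q0.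
pose Q := [set w : Sigma | periodic (q + N) i w /\
  - D <= birkhoff_sum phi N (iter q shift w)].
pose B := cylinder 0 (tmc_val x0) `&` iter q shift @^-1` F.
have qN0 : (0 < q + N)%N by rewrite addn_gt0 N0 orbT.
have BQ : B `<=` \bigcup_(w in Q) cylinder q (tmc_val w).
  move=> z [z0 zF].
  have [y [y0 yN] hy] := hND _ zF.
  have yz : tmc_val y 0 = tmc_val z q by rewrite y0 tmc_val_iter addn0.
  have [w hw wg] : exists2 w, periodic (q + N) i w & agree (q + N) w (splice q z y).
    apply: periodic_close => //.
      by rewrite tmc_val_splice// q0 z0.
    by rewrite tmc_val_splice// ltnNge leq_addr /= addKn.
  have wz : agree q z w.
    apply: agree_sym; apply: agree_trans (agree_splice yz).
    exact: agree_le (leq_addr _ _) wg.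
  exists w => //=; split=> //; apply: hy.
  rewrite -{1}(shift_splice yz); apply: agree_shift; apply: agree_sym.
  by apply: agree_le wg; rewrite leq_add2l leq_pred.
have mB : a / 2 <= fine (mu B).
  have m0 : measurable (cylinder 0 (tmc_val x0) : set Sigma).
    exact: measurable_cylinder.
  have mqF : measurable (iter q shift @^-1` F).
    by rewrite -[X in measurable X]setTI; exact: measurable_iter_shift.
  have := probability_capI_ge mu m0 mqF.
  rewrite shift_invariant_iter// -/(cylm mu 0 x0) -/a -/B; lra.
have cQ : countable Q.
  apply: sub_countable (@countable_periodic R I A A0 (q + N).-1 i).
  by apply: subset_card_le => w [+ _]; rewrite prednK.
set C := expR (q%:R * P - ln (K q) - D - ln (c i)).
apply: (@le_trans _ _ (C%:E * mu B)%E).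
  rewrite -[mu B]fineK ?fin_num_measure//; last first.
    apply: measurableI; first exact: measurable_cylinder.
    by rewrite -[X in measurable X]setTI; exact: measurable_iter_shift.
  rewrite -EFinM lee_fin; apply: (@le_trans _ _ (C * (a / 2))); last first.
    by rewrite ler_pM2l ?expR_gt0.
  have -> : C * (a / 2) = C * expR (ln (a / 2)) by rewrite lnK// posrE divr_gt0.
  by rewrite /C -expRD ler_expR; lra.
apply: (@le_trans _ _ (C%:E * \esum_(w in Q) mu (cylinder q (tmc_val w)))%E).
  apply: lee_wpmul2l; first by rewrite lee_fin expR_ge0.
  apply: (le_trans (le_measure _ _ _ BQ)).
  - rewrite inE; apply: measurableI; first exact: measurable_cylinder.
    by rewrite -[X in measurable X]setTI; exact: measurable_iter_shift.
  - rewrite inE; apply: (@measurable_agree _ _ _ _ q) => z z' zz' [w Qw zw].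
    by exists w => // r rq; rewrite -zz'// zw.
  by apply: measure_countable_subadditive => // w; exact: measurable_cylinder.
rewrite muleC -lee_pdivlMr ?expR_gt0// -expRN muleC.
apply: (@le_trans _ _ (\esum_(w in periodic (q + N) i)
    ((expR (- (q%:R * P - ln (K q) - D - ln (c i))))%:E *
     (expR (birkhoff_sum phi (q + N) w))%:E))%E); last first.
  by apply: esumZ_le => // w; rewrite lee_fin expR_ge0.
apply: (@le_trans _ _ (\esum_(w in Q)
    ((expR (- (q%:R * P - ln (K q) - D - ln (c i))))%:E *
     (expR (birkhoff_sum phi (q + N) w))%:E))%E); last first.
  apply: ge_ereal_sup => _ [X [finX XQ] <-]; apply: ereal_sup_ubound.
  by exists X => //; split=> // w /XQ[].
apply: le_esum => w [hw Dw]; rewrite cylmE -EFinM -expRD lee_fin birkhoff_sumD.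
(* A Birkhoff sum of [q] terms corresponds to the cylinder of index [q.-1], which contains the one
   of index [q]. *)
have := cylm_le mu w (leq_pred q).
have [X0] := G q.-1 w; rewrite prednK// hw.1 => /ler_normlP[_ h] hX.
have [Y0 _] := G q w.
apply: le_trans hX _; rewrite -[cylm mu q.-1 w]lnK// ler_expR; lra.
Qed.

Hypothesis K1 : forall n, (0 < n)%N -> 1 <= K n <= K n.+1.
Hypothesis K0 : ln (K n) / n%:R @[n --> \oo] --> 0.

Lemma weak_constant_ge1 n : (0 < n)%N -> 1 <= K n.
Proof. by move=> /K1/andP[]. Qed.

Lemma weak_constant_le m n : (0 < m)%N -> (m <= n)%N -> K m <= K n.
Proof.
move=> m0 mn; rewrite -(subnK mn); elim: (n - m)%N => // d IH.
by apply: le_trans IH _; have /andP[] := K1 (ltn_addl d m0).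
Qed.

Lemma ln_weak_constant_le m n : (0 < m)%N -> (m <= n)%N -> ln (K m) <= ln (K n).
Proof.
move=> m0 mn; have Km := weak_constant_ge1 m0.
have Kmn := weak_constant_le m0 mn.
by rewrite ler_ln ?posrE//; apply: lt_le_trans ltr01 _ => //; exact: le_trans Kmn.
Qed.

Lemma cvg_periodic_sum i : (n%:R^-1%:E *
     lne (\esum_(w in periodic n i) (expR (birkhoff_sum phi n w))%:E))%E
  @[n --> \oo] --> P%:E.
Proof.
have [N [D [N0 hge]]] := periodic_sum_ge i.
have cinv (a : R) : a * n%:R^-1 @[n --> \oo] --> 0.
  rewrite -[X in _ --> X](mulr0 a); apply: cvgMl_tmp.
  by apply/gtr0_cvgV0; [near=> n; rewrite ltr0n; near: n; exists 1%N|exact: cvgr_idn].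
(* The lower bound is applied with [q = n - N], whence the term [- (N%:R * P)]. *)
pose l n := P + (- (N%:R * P) - D) * n%:R^-1 - ln (K n) / n%:R.
pose u n := P + ln (c i) * n%:R^-1 + ln (K n) / n%:R.
have cl : (EFin \o l) x @[x --> \oo] --> P%:E.
  apply: cvg_EFin; first by near=> n.
  rewrite -[X in _ --> X]subr0 -[X in _ --> X - _]addr0.
  by apply: cvgB => //; apply: cvgD => //; exact: cvg_cst.
have cu : (EFin \o u) x @[x --> \oo] --> P%:E.
  apply: cvg_EFin; first by near=> n.
  rewrite -[X in _ --> X]addr0 -[X in _ --> X + _]addr0.
  by apply: cvgD => //; apply: cvgD => //; exact: cvg_cst.
apply: squeeze_cvge cl cu.
near=> n.
have nN : (N < n)%N by near: n; exists N.+1.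
have n0 : (0 < n)%N by exact: leq_ltn_trans nN.
have nR0 : (0 : R) < n%:R by rewrite ltr0n.
set Z := esum _ _.
have Zge0 : (0 <= Z)%E by apply: esum_ge0 => w _; rewrite lee_fin expR_ge0.
apply/andP; split.
  have q0 : (0 < n - N)%N by rewrite subn_gt0.
  have := hge _ q0; rewrite subnK ?(ltnW nN)// -/Z => h.
  apply: (@le_trans _ _ (n%:R^-1%:E *
      ((n - N)%:R * P - ln (K (n - N)%N) - D)%:E)%E); last first.
    apply: lee_wpmul2l; first by rewrite lee_fin invr_ge0 ltW.
    rewrite -[X in (X%:E <= _)%E]expRK -lne_EFin ?expR_gt0// lee_lne// in_itv/=.
      by rewrite lee_fin expR_ge0/= leey.
    by rewrite Zge0 leey.
  rewrite -EFinM lee_fin /l natrB ?(ltnW nN)// [leRHS]mulrC ler_pdivlMr//.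
  have := ln_weak_constant_le q0 (leq_subr N n).
  set a := ln _; set b := ln _ => ab.
  rewrite mulrBl mulrDl !divfK ?gt_eqF//.
  lra.
have := periodic_sum_le n.-1 i; rewrite prednK// -/Z => h.
apply: (@le_trans _ _ (n%:R^-1%:E *
      (n%:R * P + ln (c i) + ln (K n))%:E)%E).
  apply: lee_wpmul2l; first by rewrite lee_fin invr_ge0 ltW.
  rewrite -[X in (_ <= X%:E)%E]expRK -lne_EFin ?expR_gt0// lee_lne// in_itv/=.
    by rewrite Zge0 leey.
  by rewrite lee_fin expR_ge0/= leey.
rewrite -EFinM lee_fin /u [leLHS]mulrC ler_pdivrMr// !mulrDl !divfK ?gt_eqF//.
lra.
Unshelve. all: by end_near. Qed.

Lemma gurevich_pressureE : gurevich_pressure phi = P%:E.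
Proof.
rewrite /gurevich_pressure; set S := (X in get X).
have SP : S P%:E by move=> i; exact: cvg_periodic_sum.
(* The property selected by [get] is quantified over symbols; uniqueness of the limit is applied at
   one of them. *)
have i : I := tmc_val (point : Sigma) 0.
by apply: cvg_unique (getPex (ex_intro S _ SP) i) (SP i).
Qed.

End GurevichPressure.

(** * An averaging principle for weighted families of sets *)

Section Pigeonhole.
Set Implicit Arguments.
Unset Strict Implicit.
Local Open Scope ereal_scope.

(* The sum on the left is a function of z whose integral over B is at most
   [k^-1] times the sum of the g i over the nonempty E i. *)
Lemma weighted_pigeonhole d (T : measurableType d) (R : realType)
    (m : probability T R) (B : set T) (E : nat -> set T) (g : nat -> R) (k : R) :
  measurable B -> (forall i, measurable (E i)) -> (forall i, E i `<=` B) ->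
  (forall i, 0 <= g i)%R -> (0 < k)%R ->
  (forall i, E i !=set0 -> 0 < m (E i)) ->
  \esum_(i in [set i | E i !=set0]) (g i)%:E < k%:E * m B ->
  exists2 z, B z &
    \esum_(i in [set i | E i z]) (g i / (k * fine (m (E i))))%:E < 1.
Proof.
move=> mB mE EB g0 k0 mE0 hlt; apply: contrapT => hno.
pose a i := (g i / (k * fine (m (E i))))%R.
have a0 i : (0 <= a i)%R.
  apply: divr_ge0 => //; apply: mulr_ge0; [exact: ltW|exact: fine_ge0].
pose h (i : nat) (z : T) : \bar R := ((a i)%:E * (\1_(E i) z)%:E).
have h0 i z : 0 <= h i z by rewrite /h -EFinM lee_fin mulr_ge0.
have hB z : B z -> 1 <= \sum_(i <oo) h i z.
  move=> Bz; rewrite leNgt; apply/negP => lt1; apply: hno; exists z => //.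
  apply: le_lt_trans lt1; rewrite nneseries_esumT// esum_mkcond le_esum// => i _.
  rewrite /h indicE; have [Eiz|Eiz] := pselect (E i z).
    by rewrite !mem_set//= mule1.
  by rewrite !memNset//= mule0.
have mh i : measurable_fun B (h i).
  apply: measurable_funTS; apply: measurable_funeM.
  by apply/measurable_EFinP; exact: measurable_indic.
(* If the sum were at least 1 throughout [B], its integral would be at least [m B], against the
   bound on the weights. *)
have : m B <= \int[m]_(z in B) \sum_(i <oo) h i z.
  rewrite -[m B]mul1e -integral_cst//; apply: ge0_le_integral => //.
  by apply: ge0_emeasurable_sum => // i z _ _.
rewrite integral_nneseries// leNgt => /negP; apply.
have intE i : \int[m]_(z in B) h i z = (a i)%:E * m (E i).
  rewrite /h ge0_integralZl//; last 2 first.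
  - by apply: measurable_funTS; apply/measurable_EFinP; exact: measurable_indic.
  - by rewrite lee_fin.
  by rewrite integral_indic// setIidl.
rewrite (eq_eseriesr (fun i _ => intE i)) nneseries_esumT; last first.
  by move=> i; rewrite mule_ge0 ?lee_fin.
apply: (@le_lt_trans _ _
  (k^-1%:E * \esum_(i in [set i | E i !=set0]) (g i)%:E)); last first.
  by rewrite muleC lte_pdivrMr// muleC.
rewrite (esumID [set i | E i !=set0]); last first.
  by move=> i _; rewrite mule_ge0 ?lee_fin.
rewrite !setTI [X in _ + X]esum1 ?adde0; last first.
  by move=> i /= /set0P/negP; rewrite negbK => /eqP ->; rewrite measure0 mule0.
apply: le_trans (esumZ_le _ _ _); last 2 first.
- by rewrite invr_ge0 ltW.
- by move=> i; rewrite lee_fin.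
apply: le_esum => i /= Ei.
have finE : m (E i) \is a fin_num by rewrite fin_num_measure.
have mEi0 : (0 < fine (m (E i)))%R by rewrite -lte_fin fineK ?mE0.
rewrite -[m (E i)]fineK// -!EFinM lee_fin /a invfM mulrA divfK ?gt_eqF//.
by rewrite mulrC.
Qed.

End Pigeonhole.

(** * Growth of the weak constants and choice of times *)

Section HittingTimes.
Set Implicit Arguments.
Unset Strict Implicit.
Context {R : realType}.

Lemma limn_esup_lt (u : nat -> \bar R) (s : \bar R) : (limn_esup u < s)%E ->
  exists N, forall n, (N <= n)%N -> (u n < s)%E.
Proof.
rewrite /limn_esup limf_esupE => /ereal_inf_lt[_ [V [N _ hN] <-] hs].
exists N => n Nn; apply: le_lt_trans hs; apply: ereal_sup_ubound.
by exists n => //; exact: hN.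
Qed.

Lemma ln_weak_constant_growth (K : R^nat) :
  (forall n, (0 < n)%N -> 1 <= K n <= K n.+1) ->
  ln (K n) / n%:R @[n --> \oo] --> 0 ->
  forall e, 0 < e -> exists D, forall n, (0 < n)%N -> ln (K n) <= D + e * n%:R.
Proof.
move=> K1 K0 e e0; have /cvgrPdist_lt /(_ e e0)[N _ hN] := K0.
exists (ln (K N.+1)) => n n0.
have N0 : 0 <= ln (K N.+1) by rewrite ln_ge0// (weak_constant_ge1 K1).
have [Nn|nN] := leqP N n.
  have := hN _ Nn; rewrite /= sub0r normrN => /ltr_normlP[_].
  by rewrite ltr_pdivrMr ?ltr0n// => /ltW h; apply: le_trans h _; rewrite lerDr.
have := ln_weak_constant_le K1 n0 (leqW (ltnW nN)) => /le_trans; apply.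
by rewrite lerDl mulr_ge0// ltW.
Qed.

(** [X n] stands for the measure of C(n, w). If [l] is bounded along arbitrarily large [k], one
    fixed hitting time serves. Otherwise [k] is the largest time with [l k <= p j]; then
    [p j < l k.+1], and the rate of decay of [X] along [l] bounds [X (p j)] from below. *)
Lemma good_times (K X : R^nat) (l p : nat -> nat) (s : R) :
  (forall n, (0 < n)%N -> 1 <= K n <= K n.+1) ->
  ln (K n) / n%:R @[n --> \oo] --> 0 ->
  (~ has_ubound (range K) ->
     (limn_esup (fun n => ((l n)%:R / n%:R)%:E : \bar R) < +oo)%E) ->
  (forall j, (p j < p j.+1)%N) ->
  (forall n, 0 < X n <= 1) -> (forall m n, (m <= n)%N -> X n <= X m) ->
  (limn_esup (fun n => (n%:R^-1 * ln (X (l n))^-1)%:E) < s%:E)%E ->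
  0 < s /\ forall e, 0 < e -> exists D, forall M, exists k j,
    [/\ (M <= k)%N, (l k <= p j)%N, - (D + (s + e) * k%:R) <= ln (X (p j)) &
      forall r, ln (K (k + p j + r).+1) <= D + e * (k + r)%:R].
Proof.
move=> K1 K0 Kl pinc X01 Xle /limn_esup_lt[N1 hs].
have lnX0 n : ln (X n) <= 0 by rewrite ln_le0//; have /andP[] := X01 n.
have X0 n : 0 < X n by have /andP[] := X01 n.
have {}hs n : (N1 <= n)%N -> (0 < n)%N -> - ln (X (l n)) < n%:R * s.
  move=> Nn n0; have := hs n Nn; rewrite lte_fin lnV ?posrE//.
  by rewrite mulrC ltr_pdivrMr ?ltr0n// mulrC.
have s0 : 0 < s.
  have := hs N1.+1 (leqnSn _) isT; have := lnX0 (l N1.+1) => h1 h2.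
  have : 0 < N1.+1%:R * s by lra.
  by rewrite pmulr_rgt0.
have pge j : (j <= p j)%N.
  by elim: j => // j IH; exact: leq_ltn_trans IH (pinc j).
split=> // e e0.
have [[B hB]|hl] := pselect (exists B, forall M,
    exists2 k, (M <= k)%N & (l k <= B)%N).
  have [D1 hD1] := ln_weak_constant_growth K1 K0 e0.
  (* The index [j = B] works since [p B >= B]; all that depends on [p B] is constant and goes into
     [D]. *)
  exists (`|D1 + e * (p B).+1%:R| + `|ln (X (p B))|) => M.
  have [k Mk lk] := hB M; exists k, B; split=> //.
  - exact: leq_trans (pge B).
  - have := ler_norm (- ln (X (p B))); rewrite normrN => h1.
    have h2 : 0 <= (s + e) * k%:R by rewrite mulr_ge0// addr_ge0// ltW.
    have := normr_ge0 (D1 + e * (p B).+1%:R); lra.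
  - move=> r; have := hD1 (k + p B + r).+1 isT.
    have := ler_norm (D1 + e * (p B).+1%:R); have := normr_ge0 (ln (X (p B))).
    have -> : (k + p B + r).+1%:R = (p B).+1%:R + (k + r)%:R :> R.
      by rewrite -natrD addSn addnAC [in LHS]addnC.
    by rewrite mulrDr; lra.
have {}hl B : exists M, forall k, (M <= k)%N -> (B < l k)%N.
  apply: contrapT => /forallNP h; apply: hl; exists B => M.
  have /existsNP[k /not_implyP[Mk /negP]] := h M.
  by rewrite -leqNgt => lk; exists k.
have hmax M : exists k j, [/\ (M <= k)%N, (l k <= p j)%N & (p j < l k.+1)%N].
  (* Then [p j >= l M], so the largest [k] with [l k <= p j] is at least [M]. *)
  pose j := l M.
  have exP : exists k, (l k <= p j)%N by exists M; exact: pge.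
  have [M0 hM0] := hl (p j).
  have bdd k : (l k <= p j)%N -> (k <= M0)%N.
    move=> lk; rewrite leqNgt; apply/negP => /ltnW/hM0; by rewrite ltnNge lk.
  case: (ex_maxnP exP bdd) => k lk kmax; exists k, j; split=> //.
    by apply: kmax; exact: pge.
  by rewrite ltnNge; apply/negP => /kmax; rewrite ltnn.
have hX k j : (N1 <= k)%N -> (p j < l k.+1)%N -> - (s + s * k%:R) <= ln (X (p j)).
  move=> Nk pl; have := hs k.+1 (leqW Nk) isT.
  have : ln (X (l k.+1)) <= ln (X (p j)) by rewrite ler_ln ?posrE// Xle// ltnW.
  by rewrite -natr1 mulrDl mul1r [_ * s]mulrC; lra.
have [Kb|/Kl Kub] := pselect (has_ubound (range K)).
  case: Kb => Kmax hK; exists (s + `|ln Kmax|) => M.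
  have [k [j [Mk lk pl]]] := hmax (maxn M N1).
  exists k, j; split=> //; first exact: leq_trans (leq_maxl _ _) Mk.
    have := hX k j (leq_trans (leq_maxr _ _) Mk) pl.
    have := normr_ge0 (ln Kmax); have : 0 <= e * k%:R by rewrite mulr_ge0// ltW.
    by rewrite mulrDl; lra.
  move=> r; have Kr1 := weak_constant_ge1 K1 (isT : (0 < (k + p j + r).+1)%N).
  have Kr0 : 0 < K (k + p j + r).+1 by exact: lt_le_trans Kr1.
  have KrM : K (k + p j + r).+1 <= Kmax by apply: hK; exists (k + p j + r).+1.
  have : ln (K (k + p j + r).+1) <= ln Kmax.
    by rewrite ler_ln ?posrE//; exact: lt_le_trans KrM.
  have := ler_norm (ln Kmax); have : 0 <= e * (k + r)%:R by rewrite mulr_ge0// ltW.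
  lra.
(* For unbounded [K], [l] grows at most linearly, so [p j < l k.+1] makes the index of [K] at most
   [(C + 1) * (k + r).+1]. The growth rate allowed to [K] is therefore [e / (C + 1)]. *)
have [C C0 [N2 hC]] : exists2 C : R, 0 < C & exists N2,
    forall n, (N2 <= n)%N -> (0 < n)%N -> (l n)%:R <= C * n%:R.
  have [C hC] : exists C : R,
      (limn_esup (fun n => ((l n)%:R / n%:R)%:E : \bar R) < C%:E)%E.
    move: Kub; case: limn_esup => [x _|//|_]; last by exists 0; rewrite ltNyr.
    by exists (x + 1); rewrite lte_fin ltrDl.
  have [N2 hN2] := limn_esup_lt hC; exists (`|C| + 1); first by rewrite ltr_wpDl.
  exists N2 => n Nn n0; have := hN2 n Nn.
  rewrite lte_fin ltr_pdivrMr ?ltr0n// => /ltW h.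
  apply: le_trans h _; rewrite ler_wpM2r//; have := ler_norm C; lra.
have C10 : 0 < C + 1 by rewrite addr_gt0.
have [D1 hD1] := ln_weak_constant_growth K1 K0 (divr_gt0 e0 C10).
exists (s + `|D1 + e|) => M.
have [k [j [Mk lk pl]]] := hmax (maxn M (maxn N1 N2)).
have kN1 : (N1 <= k)%N by apply: leq_trans Mk; rewrite leq_max leq_maxl orbT.
have kN2 : (N2 <= k)%N by apply: leq_trans Mk; rewrite leq_max leq_maxr orbT.
exists k, j; split=> //; first exact: leq_trans (leq_maxl _ _) Mk.
  have := hX k j kN1 pl.
  have := normr_ge0 (D1 + e); have : 0 <= e * k%:R by rewrite mulr_ge0// ltW.
  by rewrite mulrDl; lra.
move=> r; have := hD1 (k + p j + r).+1 isT.
have pC : (p j)%:R <= C * k.+1%:R.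
  apply: le_trans (hC k.+1 (leqW kN2) isT); by rewrite ler_nat ltnW.
have h : (k + p j + r).+1%:R <= (C + 1) * (k + r).+1%:R.
  apply: (@le_trans _ _ (k%:R + C * k.+1%:R + r%:R + 1)).
    by rewrite -natr1 !natrD; lra.
  have : 0 <= C * r%:R by rewrite mulr_ge0// ltW.
  rewrite -!natr1 !natrD; lra.
have : e / (C + 1) * (k + p j + r).+1%:R <= e * (k + r).+1%:R.
  apply: le_trans (ler_wpM2l (divr_ge0 (ltW e0) (ltW C10)) h) _.
  by rewrite mulrA divfK ?gt_eqF.
have := ler_norm (D1 + e); rewrite -natr1 mulrDr mulr1; lra.
Qed.

End HittingTimes.

(** * Mass budgets of cylinders *)

Section Budget.
Set Implicit Arguments.
Unset Strict Implicit.
Context {R : realType} {I : countType} {A : rel I}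
  {A0 : admissible A !=set0}.
Local Notation Sigma := (tmc R A0).
Local Notation shift := (@tmc_shift R I A A0).
Implicit Types (x y z : Sigma).
Variables (phi : Sigma -> R) (mu : probability Sigma R) (P : R) (K : R^nat)
  (c : I -> R).
Variables (t : R) (m : probability Sigma R) (Pm : R) (Km : R^nat) (cm : I -> R).
Hypothesis G : log_gibbs phi mu P K c.
Hypothesis K1 : forall n, (0 < n)%N -> 1 <= K n <= K n.+1.
Hypothesis K0 : ln (K n) / n%:R @[n --> \oo] --> 0.
Hypothesis Gm : log_gibbs (fun z => t * phi z) m Pm Km cm.
Hypothesis Km1 : forall n, (0 < n)%N -> 1 <= Km n <= Km n.+1.
Hypothesis Km0 : ln (Km n) / n%:R @[n --> \oo] --> 0.
Hypothesis t0 : 0 < t.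
Hypothesis t1 : t <= 1.
Variable w : Sigma.

(* A cylinder C = C(L, x) is given the mass [expR T], which is to be distributed
   over its children, the sets of z in C such that the shift of z by k lies in
   C(p_j, w), proportionally to the m-measure of the shift of C by L restricted
   to the symbols L..k.  By mixing, for k large the density of this distribution
   is at most [expR T * 2 / (m[x_L] * m[w_0])], so a budget bounds the mass that
   any cylinder between C and its children receives by its mu-measure to the
   power t. *)
Definition budget x L T := forall y r, agree L x y ->
  T + ln 2 - ln (cylm m 0 (iter L shift x)) - ln (cylm m 0 w)
    + ln (cylm m r (iter L shift y)) <= t * ln (cylm mu (L + r)%N y).

(** The Gibbs inequality determines the sum on a cylinder up to constants of that cylinder. *)
Lemma birkhoff_sum_lb x L : exists b, forall y, agree L x y ->
  b <= birkhoff_sum phi L y.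
Proof.
case: L => [|L]; first by exists 0 => y _; rewrite /birkhoff_sum big_ord0.
exists (ln (cylm mu L x) + L.+1%:R * P - (ln (c (tmc_val x 0)) + ln (K L.+1))).
move=> y xy; have [_] := G L y.
rewrite -(cylm_agree mu (agree_le (leqnSn L) xy)) -(xy 0%N)//.
by move=> /ler_normlP[_ h]; lra.
Qed.

Lemma gibbs_ub n y :
  ln (cylm m n y) <=
  - (n.+1%:R * Pm) + t * birkhoff_sum phi n.+1 y
    + ln (cm (tmc_val y 0)) + ln (Km n.+1).
Proof. by have [_ /ler_normlP[_]] := Gm n y; rewrite birkhoff_sumZ; lra. Qed.

Lemma gibbs_lb n y :
  - (n.+1%:R * Pm) + t * birkhoff_sum phi n.+1 y
    - ln (cm (tmc_val y 0)) - ln (Km n.+1)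
  <= ln (cylm m n y).
Proof. by have [_ /ler_normlP[+ _]] := Gm n y; rewrite birkhoff_sumZ; lra. Qed.

(** Comparing the Gibbs bounds for [m] and [mu] leaves a factor decaying at rate
    [Delta = Pm - t * P] in [r]. Each of the two weak constants may grow at half that rate, so what
    remains is bounded and a low enough [T] absorbs it. *)
Lemma base_budget x L : 0 < Pm - t * P -> exists T, budget x L T.
Proof.
move=> Delta0; have [b hb] := birkhoff_sum_lb x L.
set Delta := Pm - t * P in Delta0.
have e0 : 0 < Delta / 2 by rewrite divr_gt0.
have [D hD] := ln_weak_constant_growth K1 K0 e0.
have [Dm hDm] := ln_weak_constant_growth Km1 Km0 e0.
exists (- (ln 2 - ln (cylm m 0 (iter L shift x)) - ln (cylm m 0 w))
  - t * L%:R * P + t * b - t * ln (c (tmc_val x 0)) - (D + Delta / 2 * L%:R)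
  - ln (cm (tmc_val x L)) - Dm).
have r0 r : (0 < L + r.+1)%N by rewrite addnS.
move=> y r xy; have := hb y xy; have := hD _ (r0 r); have := hDm r.+1 isT.
have := gibbs_ub r (iter L shift y); rewrite tmc_val_iter addn0 -xy//.
have [_ /ler_normlP[h _]] := G (L + r)%N y.
move: h; rewrite -addnS birkhoff_sumD -xy//.
set S1 := birkhoff_sum _ L _; set S2 := birkhoff_sum _ _ _.
set X := ln (cylm mu _ _); set Y := ln (cylm m r _).
set kappa := ln (K _); set kappam := ln (Km _).
move=> h1 h2 h3 h4 h5.
have kappa0 : 0 <= kappa by rewrite ln_ge0// (weak_constant_ge1 K1).
have tk : t * kappa <= kappa by rewrite ler_piMl.
have t0' := ltW t0.
have g1 : t * (- X - (L + r.+1)%:R * P + (S1 + S2)) <=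
    t * (ln (c (tmc_val x 0)) + kappa).
  by apply: ler_wpM2l => //; lra.
have g2 : t * b <= t * S1 by apply: ler_wpM2l.
have rE : r.+1%:R = r%:R + 1 :> R by rewrite natr1.
by move: h3 h2 h4 g1; rewrite /Delta !natrD rE; lra.
Qed.

(** After the cost of the visit to C(p_j, w), a gain of [k%:R * (Pm - t * P - s * t)], that is five
    times [e * k%:R], is left. It pays for the growth in [k] of [Km r], of [K (p j).+1] and of [K]
    at the final depth, for the slack [e] in the rate [s + e], and for the constants. *)
Lemma child_budget x L T (p : nat -> nat) (s D Cm : R) :
  0 < s -> s * t < Pm - t * P ->
  (forall j, ln (cm (tmc_val w (p j))) <= Cm) ->
  let e := (Pm - t * P - s * t) / 5 in
  exists k0, forall k j, (k0 <= k)%N -> 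
    - (D + (s + e) * k%:R) <= ln (cylm mu (p j) w) ->
    (forall r, ln (K (k + p j + r).+1) <= D + e * (k + r)%:R) ->
    forall r z T', k = (L + r)%N -> (0 < r)%N ->
    tmc_val z 0 = tmc_val x L -> tmc_val z r = tmc_val w 0 ->
    T' <= T + ln 2 - ln (cylm m 0 (iter L shift x)) - ln (cylm m 0 w)
      + ln (cylm m r z) ->
    budget (splice L x (splice r z w)) (k + p j)%N T'.
Proof.
move=> s0 st hCm e.
have e0 : 0 < e by rewrite divr_gt0// subr_gt0.
have [b hb] := birkhoff_sum_lb x L.
have [Dm hDm] := ln_weak_constant_growth Km1 Km0 e0.
(* [B0] collects all the terms that do not depend on [k], [j] and [z]. *)
pose B0 := T + ln 2 - ln (cylm m 0 (iter L shift x)) - ln (cylm m 0 w)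
  + ln (cm (tmc_val x L)) + Dm + ln 2 - ln (cylm m 0 w) + Pm + 2 * Cm
  + ln (Km 1) + Dm + e - Pm + L%:R * Pm - t * b + t * ln (c (tmc_val w 0))
  + t * ln (c (tmc_val x 0)) + D + D + t * D.
have [k0 hk0] : exists k0, forall k, (k0 <= k)%N -> B0 <= e * k%:R.
  exists (Num.bound (`|B0| / e)) => k kk0.
  have := archi_boundP (divr_ge0 (normr_ge0 B0) (ltW e0)).
  rewrite ltr_pdivrMr// => h; apply: le_trans (ler_norm _) _.
  apply: le_trans (ltW h) _; rewrite mulrC; apply: ler_wpM2l; first exact: ltW.
  by rewrite ler_nat.
exists k0 => k j kk0 hX hK r z T' kE r0 z0 zr hT' y r' hy.
set q := p j in hX hK hy *.
have gz : tmc_val (splice r z w) 0 = tmc_val x L by rewrite (agree_splice (esym zr))// z0.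
have xy : agree L x y.
  apply: agree_sym; apply: agree_trans (agree_splice gz); apply: agree_sym.
  by apply: agree_le hy; rewrite kE -addnA leq_addr.
have uz : agree r z (iter L shift y).
  apply: agree_sym; apply: agree_trans (agree_splice (esym zr)); apply: agree_sym.
  rewrite -[splice r z w](shift_splice gz); apply: agree_shift.
  by apply: agree_le hy; rewrite kE leq_addr.
have wy : agree q w (iter k shift y).
  have -> : w = iter k shift (splice L x (splice r z w)).
    by rewrite kE addnC iterD shift_splice// shift_splice.
  exact: agree_shift.
have u0 : tmc_val (iter L shift y) 0 = tmc_val x L by rewrite -uz.
set v := iter (k + q)%N shift y.
have vE : v = iter q shift (iter k shift y) by rewrite /v addnC iterD.
have v0 : tmc_val v 0 = tmc_val w q by rewrite vE tmc_val_iter addn0 -wy.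
have y0 : tmc_val y 0 = tmc_val x 0 by rewrite -xy.
have Yr : ln (cylm m r z) <= - (r%:R * Pm) + t * birkhoff_sum phi r (iter L shift y)
    + ln (cm (tmc_val x L)) + ln (Km r).
  have := gibbs_ub r.-1 (iter L shift y); rewrite prednK// u0.
  apply: le_trans; rewrite (cylm_agree m uz).
  by rewrite ler_ln ?posrE ?cylm_le ?leq_pred//;
    [case: (Gm r (iter L shift y))|case: (Gm r.-1 (iter L shift y))].
have Yr' := gibbs_ub r' v; rewrite v0 in Yr'.
(* The position [k + q] is counted both in the block of [w] and in the remainder [v]; the term
   [t * phi v] from this bound cancels the double count. *)
have Y0 := gibbs_lb 0 v; rewrite v0 birkhoff_sum1 in Y0.
have Xp : ln (cylm mu q w) + q.+1%:R * P - ln (c (tmc_val w 0)) - ln (K q.+1)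
    <= birkhoff_sum phi q.+1 (iter k shift y).
  have [_ /ler_normlP[_]] := G q (iter k shift y).
  by rewrite -(cylm_agree mu wy) -(wy 0%N)//; lra.
have X : - ((k + q + r').+1%:R * P) + birkhoff_sum phi (k + q + r').+1 y
    - ln (c (tmc_val x 0)) - ln (K (k + q + r').+1) <= ln (cylm mu (k + q + r')%N y).
  by have [_ /ler_normlP[+ _]] := G (k + q + r')%N y; rewrite y0; lra.
have vx : cylm m 0 (iter (k + q)%N shift (splice L x (splice r z w))) = cylm m 0 v.
  by apply: cylm_agree; apply: agree_shift; rewrite addn0.
rewrite -/v vx.
have Sy : birkhoff_sum phi (k + q + r').+1 y = birkhoff_sum phi L y +
    birkhoff_sum phi r (iter L shift y) + birkhoff_sum phi q (iter k shift y) +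
    birkhoff_sum phi r'.+1 v.
  by rewrite -addnS birkhoff_sumD birkhoff_sumD {1}kE birkhoff_sumD.
have Sq : birkhoff_sum phi q.+1 (iter k shift y) =
    birkhoff_sum phi q (iter k shift y) + phi v.
  by rewrite -addn1 birkhoff_sumD birkhoff_sum1 -vE.
have Sb := hb y xy.
have Kr' := hK r'.
have Kq : ln (K q.+1) <= D + e * k%:R.
  have := hK 0%N; rewrite !addn0; apply: le_trans; apply: ln_weak_constant_le => //.
  by rewrite ltnS leq_addl.
have Kmr := hDm r r0.
have Kmr' := hDm r'.+1 isT.
have Bk := hk0 k kk0.
have Cmj := hCm j; rewrite -/q in Cmj.
rewrite Sy in X; rewrite Sq in Xp.
set S1 := birkhoff_sum phi L y in X Sb.
set S2 := birkhoff_sum phi r _ in X Yr.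
set S3 := birkhoff_sum phi q _ in X Xp.
set S4 := birkhoff_sum phi r'.+1 v in X Yr'.
set Xf := ln (cylm mu (k + q + r')%N y) in X *.
set X1 := ln (cylm mu q w) in Xp hX.
set k1 := ln (K q.+1) in Xp Kq.
set k2 := ln (K _) in X Kr'.
have k10 : 0 <= k1 by rewrite ln_ge0// (weak_constant_ge1 K1).
have k20 : 0 <= k2 by rewrite ln_ge0// (weak_constant_ge1 K1).
have tk1 : t * k1 <= k1 by rewrite ler_piMl.
have tk2 : t * k2 <= k2 by rewrite ler_piMl.
have t0' := ltW t0.
have tX : t * (- ((k + q + r').+1%:R * P) + (S1 + S2 + S3 + S4)
    - ln (c (tmc_val x 0)) - k2)
  <= t * Xf by exact: ler_wpM2l.
have tXp : t * (X1 + q.+1%:R * P - ln (c (tmc_val w 0)) - k1) <= t * (S3 + phi v).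
  exact: ler_wpM2l.
have tb : t * b <= t * S1 by exact: ler_wpM2l.
have thX : t * - (D + (s + e) * k%:R) <= t * X1 by exact: ler_wpM2l.
have tek : t * (e * k%:R) <= e * k%:R by rewrite ler_piMl// mulr_ge0// ltW.
have er' : 5 * (e * r'%:R) + s * t * r'%:R = (Pm - t * P) * r'%:R.
  by rewrite /e; field.
have ek : 5 * (e * k%:R) + s * t * k%:R = (Pm - t * P) * k%:R.
  by rewrite /e; field.
have str : 0 <= s * t * r'%:R by rewrite !mulr_ge0// ltW.
have er0 : 0 <= e * r'%:R by rewrite mulr_ge0// ltW.
have erk : e * r%:R <= e * k%:R.
  by apply: ler_wpM2l; [exact: ltW|rewrite ler_nat kE leq_addl].
have kR : k%:R = L%:R + r%:R :> R by rewrite kE natrD.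
clearbody e S1 S2 S3 S4 Xf X1 k1 k2.
have N1 : (k + q + r').+1%:R = k%:R + q%:R + r'%:R + 1 :> R by rewrite -natr1 !natrD.
have N2 : q.+1%:R = q%:R + 1 :> R by rewrite natr1.
have N3 : r'.+1%:R = r'%:R + 1 :> R by rewrite natr1.
have N4 : (k + r')%:R = k%:R + r'%:R :> R by rewrite natrD.
rewrite N1 in tX; rewrite N2 in tXp; rewrite N3 in Kmr' Yr'; rewrite N4 in Kr'.
have rR : r%:R = k%:R - L%:R :> R by lra.
rewrite rR in Yr.
rewrite /B0 in Bk.
lra.
Qed.

(** * Cylinders that a given cover is too light to fill *)

Section Cover.
Variables (J : set nat) (F : nat -> set Sigma) (nF : nat -> nat) (g : nat -> R).
Hypothesis FE : forall i, J i -> forall y, F i y ->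
  F i = cylinder (nF i) (tmc_val y).
Hypothesis g0 : forall i, 0 <= g i.
Hypothesis gF : forall i, J i -> forall y, F i y ->
  expR (t * ln (cylm mu (nF i) y)) <= g i.

Definition meeting (C : set Sigma) : set nat := [set i | J i /\ F i `&` C !=set0].

(** The part of the cover that meets the cylinder weighs less than the mass [expR T] given to it. *)
Definition light x L T :=
  (\esum_(i in meeting (cylinder L (tmc_val x))) (g i)%:E < (expR T)%:E)%E.

Lemma le_esum_subset (S1 S2 : set nat) : S1 `<=` S2 ->
  (\esum_(i in S1) (g i)%:E <= \esum_(i in S2) (g i)%:E)%E.
Proof.
move=> S12; apply: ge_ereal_sup => _ [X [finX XS] <-].
by apply: ereal_sup_ubound; exists X => //; split=> //; exact: subset_trans S12.
Qed.

Lemma cylm_gt0 n z : 0 < cylm m n z.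
Proof. by case: (Gm n z). Qed.

(** The measure tends to the product, so it is eventually at least half of it; this half is the
    [ln 2] of [budget]. *)
Lemma mixing_lb z : mixing m -> exists r0, forall r, (r0 <= r)%N ->
  cylm m 0 z * cylm m 0 w / 2 <=
  fine (m (cylinder 0 (tmc_val z) `&` iter r shift @^-1` cylinder 0 (tmc_val w))).
Proof.
move=> mix; have := mix _ _ (@measurable_cylinder R I A A0 0 (tmc_val z))
  (@measurable_cylinder R I A A0 0 (tmc_val w)).
rewrite !cylmE -EFinM => /fine_cvgP[_ /cvgrPdist_le].
have d0 : 0 < cylm m 0 z * cylm m 0 w / 2 by rewrite divr_gt0// mulr_gt0// cylm_gt0.
move=> /(_ _ d0)[r0 _ hr0]; exists r0 => r /hr0 /= /ler_normlP[_]; lra.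
Qed.

Variables (l p : nat -> nat) (s Cm : R).
Hypothesis mix : mixing m.
Hypothesis s0 : 0 < s.
Hypothesis st : s * t < Pm - t * P.
Hypothesis hCm : forall j, ln (cm (tmc_val w (p j))) <= Cm.
Hypothesis hgood : forall e, 0 < e -> exists D, forall M, exists k j,
  [/\ (M <= k)%N, (l k <= p j)%N,
    - (D + (s + e) * k%:R) <= ln (cylm mu (p j) w) &
    forall r, ln (K (k + p j + r).+1) <= D + e * (k + r)%:R].

(** Averaging over the children gives one for which the weights [g i], each divided by the total
    mass of the children that meet [F i], sum to less than 1. By the budget, no covering set of
    index at most [k] meets this child. The longer ones meet no other child, so the sum compares the
    cover with the mass of this child alone. *)
Lemma light_child x L T M :
  budget x L T -> light x L T ->
  exists x' L' T', [/\ (L < L')%N, agree L x' x, budget x' L' T', light x' L' T' &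
    exists2 k, (M <= k)%N & (k + l k <= L')%N /\ agree (l k) (iter k shift x') w].
Proof.
move=> hT lT.
pose e := (Pm - t * P - s * t) / 5.
have e0 : 0 < e by rewrite divr_gt0// subr_gt0.
have [D hD] := hgood e0.
have [k0 hk0] := @child_budget x L T p s D Cm s0 st hCm.
have [r0 hr0] := mixing_lb (iter L shift x) mix.
(* [k] is beyond the required [M], the threshold of the child's budget, and [L + r0], so that mixing
   applies over the gap [r = k - L]. *)
have [k [j [Mk lp hX hK]]] := hD (maxn M (maxn k0 (L + r0).+1)).
move: Mk; rewrite !geq_max => /and3P[Mk kk0 Lk].
pose r := (k - L)%N; pose q := p j; pose L' := (k + q)%N.
have Llk : (L < k)%N by exact: leq_ltn_trans (leq_addr r0 L) Lk.
have kE : k = (L + r)%N by rewrite subnKC// ltnW.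
have rpos : (0 < r)%N by rewrite subn_gt0.
have r0r : (r0 <= r)%N by rewrite -(leq_add2l L) -kE ltnW.
pose b := cylinder 0 (tmc_val (iter L shift x)) : set Sigma.
pose B := b `&` iter r shift @^-1` cylinder 0 (tmc_val w).
have BP z : B z -> tmc_val z 0 = tmc_val x L /\ tmc_val z r = tmc_val w 0.
  move=> [/(_ 0%N isT) + /(_ 0%N isT)]; by rewrite !tmc_val_iter !addn0.
have BPr z : tmc_val z 0 = tmc_val x L -> tmc_val z r = tmc_val w 0 -> B z.
  by move=> z0 zr; split=> [[|//] _|[|//] _]; rewrite ?tmc_val_iter ?addn0.
(* The child follows [x] up to [L], then [z] over the gap, then [w] from time [k] on; it depends on
   [z] only up to [r]. *)
pose ch z := splice L x (splice r z w).
have chP z : B z -> [/\ agree L (ch z) x, agree r (iter L shift (ch z)) z &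
    iter k shift (ch z) = w].
  move=> /BP[z0 zr].
  have gz : tmc_val (splice r z w) 0 = tmc_val x L by rewrite (agree_splice (esym zr))// z0.
  split; first exact: agree_splice.
    by rewrite shift_splice//; exact: agree_splice.
  by rewrite kE addnC iterD shift_splice// shift_splice.
have chE z z' : B z -> agree r z z' -> B z' /\ ch z = ch z'.
  move=> Bz zz'; have [z0 zr] := BP z Bz.
  have z0' : tmc_val z' 0 = tmc_val x L by rewrite -zz'.
  have zr' : tmc_val z' r = tmc_val w 0 by rewrite -zz'.
  split; first exact: BPr.
  have gz : tmc_val (splice r z w) 0 = tmc_val x L by rewrite (agree_splice (esym zr))// z0.
  have gz' : tmc_val (splice r z' w) 0 = tmc_val x L by rewrite (agree_splice (esym zr'))// z0'.
  have wz := esym zr; have wz' := esym zr'.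
  apply: tmc_inj => n; rewrite !tmc_val_splice ?rpos//; case: ifPn => // _.
  by case: ifPn => // nr; rewrite zz'// ltnW.
have chk y z : B y -> B z -> agree k (ch y) (ch z) -> agree r y z.
  move=> /chP[_ h _] /chP[_ h' _] yz.
  apply: agree_trans (agree_sym h) _; apply: agree_trans h'.
  by apply: agree_shift; rewrite -kE.
pose E i := [set z | B z /\ meeting (cylinder L' (tmc_val (ch z))) i].
have mcyl n y : measurable (cylinder n (tmc_val y) : set Sigma).
  exact: measurable_cylinder.
have mB : measurable B.
  apply: (@measurable_agree _ _ _ _ r) => z z' zz' Bz.
  by have [] := chE z z' Bz zz'.
have mE i : measurable (E i).
  apply: (@measurable_agree _ _ _ _ r) => z z' zz' [Bz hz].
  by have [Bz' h] := chE z z' Bz zz'; split=> //; rewrite -h.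
have cylB z : B z -> cylinder r (tmc_val z) `<=` B.
  by move=> Bz z' z'z; have [] := chE z z' Bz (agree_sym z'z).
have mBlb : cylm m 0 (iter L shift x) * cylm m 0 w / 2 <= fine (m B) := hr0 r r0r.
have mB0 : 0 < fine (m B).
  by apply: lt_le_trans mBlb; rewrite divr_gt0// mulr_gt0// cylm_gt0.
(* The density with respect to [m] on [B] of the distributed mass [expR T]. *)
pose kappa := expR T / fine (m B).
have kappa0 : 0 < kappa by rewrite divr_gt0// expR_gt0.
have ElbE i z : E i z -> cylinder r (tmc_val z) `<=` E i.
  move=> [Bz hz] z' z'z; have [Bz' h] := chE z z' Bz (agree_sym z'z).
  by split=> //; rewrite -h.
have [z Bz hz] : exists2 z, B z &
    (\esum_(i in [set i | E i z]) (g i / (kappa * fine (m (E i))))%:E < 1)%E.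
  apply: weighted_pigeonhole => //.
  - by move=> i ? [].
  - move=> i [z Eiz]; apply: (@lt_le_trans _ _ (m (cylinder r (tmc_val z)))).
      by rewrite cylmE lte_fin cylm_gt0.
    by apply: le_measure; rewrite ?inE//; exact: ElbE.
  rewrite -[m B]fineK ?fin_num_measure// -EFinM /kappa divfK ?gt_eqF//.
  apply: le_lt_trans lT; apply: le_esum_subset => i [z [Bz [Ji [y [Fy hy]]]]].
  split=> //; exists y; split=> // a aL.
  have [chx _ _] := chP z Bz.
  by rewrite (hy a) ?chx// (leq_trans aL)// /L' kE -addnA leq_addr.
(* [expR T'] is the share [kappa * cylm m r z] of the child [ch z]. *)
pose T' := T + ln (cylm m r z) - ln (fine (m B)).
have [z0 zr] := BP z Bz.
have lnmB : ln (cylm m 0 (iter L shift x)) + ln (cylm m 0 w) - ln 2 <= ln (fine (m B)).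
  rewrite -lnM ?posrE ?cylm_gt0// -ln_div ?posrE ?mulr_gt0 ?cylm_gt0//.
  by rewrite ler_ln ?posrE ?divr_gt0 ?mulr_gt0 ?cylm_gt0.
have [chx chz _] := chP z Bz.
have kL' : (k <= L')%N by rewrite leq_addr.
have kappaE : kappa = expR (T - ln (fine (m B))).
  by rewrite /kappa expRD expRN lnK.
have T'E : expR T' = kappa * cylm m r z.
  by rewrite kappaE /T' -[in RHS](lnK (cylm_gt0 r z)) -expRD; congr expR; lra.
have fmE i : m (E i) \is a fin_num by rewrite fin_num_measure.
have Egt0 i : E i z -> 0 < fine (m (E i)).
  move=> Eiz; rewrite -lte_fin fineK//.
  apply: (@lt_le_trans _ _ (m (cylinder r (tmc_val z)))).
    by rewrite cylmE lte_fin cylm_gt0.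
  by apply: le_measure; rewrite ?inE//; exact: ElbE.
(* A covering set of length at most k contributes at least 1 to the sum hz. *)
have long i : E i z -> (k < nF i)%N.
  move=> Eiz; rewrite ltnNge; apply/negP => nk.
  have [_ [Ji [y [Fy hy]]]] := Eiz.
  have Fiy := FE Ji Fy.
  have ych : agree (nF i) y (ch z).
    by move=> a an; rewrite hy// (leq_trans an)// (leq_trans nk).
  (* Children meeting [F i] agree with [ch z] up to [nF i]. If [nF i <= L], the truncated difference
     is 0 and only the symbol at [L] is compared. *)
  have Esub : E i `<=` cylinder (nF i - L) (tmc_val (iter L shift (ch z))).
    move=> z' [Bz' [_ [y' [Fy' hy']]]].
    have [chx' chz' _] := chP z' Bz'.
    have zz' : agree (nF i) (ch z') (ch z).
      move=> a an; rewrite -(ych a an) -hy' ?(leq_trans an)// ?(leq_trans nk)//.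
      by move: Fy'; rewrite Fiy => ->.
    move=> a an; have [z'0 z'r] := BP z' Bz'.
    have [nL|Ln] := leqP (nF i) L.
      move: an; rewrite (eqP nL) leqn0 => /eqP ->.
      by rewrite z'0 chz// z0.
    have aLn : (L + a <= nF i)%N by rewrite -leq_subRL// ltnW.
    rewrite -chz'; last by rewrite -(leq_add2l L) -kE (leq_trans aLn).
    by rewrite !tmc_val_iter zz'.
  have hi : kappa * fine (m (E i)) <= g i.
    apply: le_trans (gF Ji Fy).
    apply: (@le_trans _ _ (kappa * cylm m (nF i - L) (iter L shift (ch z)))).
      rewrite ler_pM2l// -lee_fin fineK// -cylmE; apply: le_measure; rewrite ?inE//.
    rewrite (cylm_agree mu ych) kappaE -[X in _ * X](lnK (cylm_gt0 _ _)).
    rewrite -expRD ler_expR.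
    (* The budget bounds the mass at depth [L + (nF i - L)], which exceeds [nF i] when [nF i < L];
       monotonicity of [mu] covers that case. *)
    have := hT (ch z) (nF i - L)%N (agree_sym chx).
    have : t * ln (cylm mu (L + (nF i - L))%N (ch z)) <=
        t * ln (cylm mu (nF i) (ch z)).
      have [X1 _] := G (L + (nF i - L))%N (ch z); have [X2 _] := G (nF i) (ch z).
      by rewrite ler_pM2l// ler_ln ?posrE// cylm_le// -leq_subLR.
    lra.
  suff : (1 <= \esum_(i in [set i | E i z]) (g i / (kappa * fine (m (E i))))%:E)%E.
    by rewrite leNgt hz.
  apply: (@le_trans _ _ (g i / (kappa * fine (m (E i))))%:E).
    by rewrite lee_fin ler_pdivlMr ?mul1r// mulr_gt0// Egt0.
  apply: ereal_sup_ubound; exists [set i]; last by rewrite fsbig_set1.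
  by split=> // ? ->.
(* A covering set of index above [k] fixes the symbols up to [k], hence the child it meets. *)
have short i : E i z -> fine (m (E i)) = cylm m r z.
  move=> Eiz; suff -> : E i = cylinder r (tmc_val z) by [].
  apply/seteqP; split; last exact: ElbE.
  move=> z' [Bz' [_ [y' [Fy' hy']]]].
  have [_ [Ji [y [Fy hy]]]] := Eiz.
  apply: (chk _ _ Bz' Bz) => a ak; have aL' := leq_trans ak kL'.
  rewrite -hy'// -hy//; move: Fy'; rewrite (FE Ji Fy) => -> //.
  exact: leq_trans ak (ltnW (long i Eiz)).
have light' : light (ch z) L' T'.
  rewrite /light.
  have -> : meeting (cylinder L' (tmc_val (ch z))) = [set i | E i z].
    by apply/seteqP; split=> [i hi|i []].
  apply: (@le_lt_trans _ _ ((expR T')%:E * \esum_(i in [set i | E i z])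
      (g i / (kappa * fine (m (E i))))%:E)%E).
    apply: le_trans (esumZ_le _ _ _); last 2 first.
    - exact: expR_ge0.
    - move=> i; rewrite lee_fin; apply: divr_ge0 => //.
      by apply: mulr_ge0; [exact: ltW|exact: fine_ge0].
    apply: le_esum => i Eiz; rewrite -EFinM lee_fin (short i Eiz) -T'E.
    by rewrite mulrC divfK// gt_eqF// expR_gt0.
  by rewrite -[ltRHS]mule1 lte_pmul2l// lte_fin expR_gt0.
exists (ch z), L', T'; split.
- by rewrite /L' kE -addnA -[X in (X < _)%N]addn0 ltn_add2l addn_gt0 rpos.
- by have [] := chP z Bz.
- apply: (hk0 k j kk0 hX hK r z T' kE rpos z0 zr); rewrite /T'; lra.
- exact: light'.
- exists k => //; split; first by rewrite leq_add2l.
  by have [_ _ ->] := chP z Bz.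
Qed.

(** The budget at [r = 0]: the measures of the symbol at [L] cancel, and the remaining terms [ln 2]
    and [- ln (cylm m 0 w)] are nonnegative. *)
Lemma budget_heavy x L T z : budget x L T -> agree L x z ->
  expR T <= expR (t * ln (cylm mu L z)).
Proof.
move=> hT xz; rewrite ler_expR; have := hT z 0%N xz; rewrite addn0.
have -> : cylm m 0 (iter L shift z) = cylm m 0 (iter L shift x).
  by apply: cylm_agree; apply: agree_shift; rewrite addn0; exact: agree_sym.
have : 0 <= ln (2 : R) by rewrite ln_ge0// ler1n.
have : ln (cylm m 0 w) <= 0 by rewrite ln_le0// cylm_le1.
lra.
Qed.

(** Iterating [light_child] gives nested cylinders with a common point [z]. If [F i] contained [z],
    it would contain the cylinder of stage [nF i] and weigh at least its mass, by [budget_heavy],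
    although that cylinder is light. *)
Lemma escape x0 N T0 :
  budget x0 N T0 -> light x0 N T0 ->
  exists2 z, W_shift (cylinder N (tmc_val x0)) l w z & forall i, J i -> ~ F i z.
Proof.
move=> hT0 lT0.
pose ok (S : Sigma * nat * R) := budget S.1.1 S.1.2 S.2 /\ light S.1.1 S.1.2 S.2.
(* The state is [(x, L, T)]; the extra number is the stage, used as the lower bound on the new time
   [k]. *)
have /choice[f hf] : forall nS : nat * (Sigma * nat * R), exists S', ok nS.2 ->
    [/\ ok S', (nS.2.1.2 < S'.1.2)%N, agree nS.2.1.2 S'.1.1 nS.2.1.1 &
      exists2 k, (nS.1 <= k)%N & (k + l k <= S'.1.2)%N /\
        agree (l k) (iter k shift S'.1.1) w].
  move=> [M [[x L] T]] /=; have [[bx lx]|nok] := pselect (ok (x, L, T)); last first.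
    by exists (x, L, T).
  have [x' [L' [T' [LL' xx' bx' lx' hk]]]] := light_child M bx lx.
  by exists (x', L', T').
pose S := fix S n := if n is n'.+1 then f (n', S n') else (x0, N, T0).
have okS n : ok (S n).
  by elim: n => [|n IH] //; have [] := hf (n, S n) IH.
pose x n := (S n).1.1; pose L n := (S n).1.2.
have LS n : (L n < L n.+1)%N by have [] := hf (n, S n) (okS n).
have xS n : agree (L n) (x n.+1) (x n) by have [] := hf (n, S n) (okS n).
have Lge n : (n <= L n)%N by elim: n => // n IH; exact: leq_ltn_trans (LS n).
have Lle i j : (i <= j)%N -> (L i <= L j)%N.
  move=> ij; rewrite -(subnK ij); elim: (j - i)%N => // d IH.
  by rewrite addSn; apply: leq_trans IH (ltnW (LS _)).
have xx i j : (i <= j)%N -> agree (L i) (x j) (x i).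
  move=> ij; rewrite -(subnK ij); elim: (j - i)%N => // d IH.
  rewrite addSn; apply: agree_trans IH; apply: agree_le (xS _).
  by apply: Lle; rewrite leq_addl.
(* The symbols of [x n] up to [L n] no longer change, and [n <= L n], so the diagonal is the
   limit. *)
pose zv n := tmc_val (x n) n.
have zx n r : (r <= L n)%N -> zv r = tmc_val (x n) r.
  move=> rL; rewrite /zv; have [rn|nr] := leqP r n; first by rewrite (xx r n).
  by rewrite (xx n r)// ltnW.
have zadm : admissible A zv.
  move=> n; rewrite (zx n.+1 n) ?(ltnW (Lge n.+1))// (zx n.+1 n.+1)//.
  exact: tmc_admissible.
pose z : Sigma := mk_tmc zadm.
have zS n : agree (L n) z (x n) by move=> r rL; rewrite tmc_val_mk (zx n).
exists z.
  split; first exact: zS 0%N.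
  move=> /finite_seqP[q qE].
  have [B hB] : exists B, forall k,
      cylinder (l k) (tmc_val w) (iter k shift z) -> (k < B)%N.
    exists (\max_(i <- q) i).+1 => k hk; rewrite ltnS; apply: leq_bigmax_seq => //.
    have : [set k | cylinder (l k) (tmc_val w) (iter k shift z)] k by [].
    by rewrite qE.
  (* Stage [B] provides a hitting time [k >= B], so the set of hitting times is not bounded by
     [B]. *)
  have [_ _ _ [k Bk [kl hk]]] := hf (B, S B) (okS B).
  suff : (k < B)%N by rewrite ltnNge Bk.
  apply: hB => r rl; rewrite -hk// !tmc_val_iter.
  by rewrite (zS B.+1)// (leq_trans _ kl)// leq_add2l.
move=> i Ji Fz; have [bS lS] := okS (nF i).
suff h : ((expR (S (nF i)).2)%:E <= \esum_(i in
    meeting (cylinder (L (nF i)) (tmc_val (x (nF i))))) (g i)%:E)%E.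
  by move: lS; rewrite /light ltNge h.
apply: (@le_trans _ _ (g i)%:E).
  rewrite lee_fin; apply: le_trans (gF Ji Fz).
  apply: le_trans (budget_heavy bS (agree_sym (zS _))) _.
  rewrite ler_expR ler_pM2l//.
  have [X1 _] := G (L (nF i)) z; have [X2 _] := G (nF i) z.
  by rewrite ler_ln ?posrE// cylm_le.
apply: ereal_sup_ubound; exists [set i]; last by rewrite fsbig_set1.
by split=> // ? ->; split=> //; exists z; split=> // r rL; exact: zS.
Qed.

End Cover.
End Budget.

(** * From covers to the dimension bound *)

Section Dimension.
Set Implicit Arguments.
Unset Strict Implicit.
Context {R : realType} {I : countType} {A : rel I}
  {A0 : admissible A !=set0}.
Local Notation Sigma := (tmc R A0).

Lemma cylinder_mem n s (y : Sigma) : cylinder n s y ->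
  cylinder n s = cylinder n (tmc_val y) :> set Sigma.
Proof. by move=> ys; apply/seteqP; split=> z zs r rn; rewrite zs// ys. Qed.

Lemma cyl_continuousZ (phi : Sigma -> R) t :
  cyl_continuous phi -> cyl_continuous (fun z => t * phi z).
Proof.
move=> cphi y e e0; have t0 : 0 < `|t| + 1 by rewrite ltr_wpDl.
have [M hM] := cphi y _ (divr_gt0 e0 t0); exists M => y' /hM.
rewrite ltr_pdivlMr// -mulrBr normrM mulrDr mulr1 => h.
by apply: le_lt_trans h; rewrite mulrC lerDl.
Qed.

(** The premeasure is nonincreasing in the scale, so its limit at 0 is a supremum and already the
    infimum at scale 1 is below [eta]. *)
Lemma small_cover (mu : probability Sigma R) alpha (E : set Sigma) (eta : R) :
  M_alpha mu alpha E = 0%E -> 0 < eta ->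
  exists (J : set nat) (F : nat -> set Sigma),
    [/\ E `<=` \bigcup_(i in J) F i,
        forall i, J i -> exists n, is_cylinder n (F i) &
        (\esum_(i in J) (mu (F i) `^ alpha) < eta%:E)%E].
Proof.
move=> M0 eta0; set f := cylinder_premeasure mu alpha E.
have fni : {in Interval (BRight (0:R)) +oo%O &, nonincreasing_fun f}.
  move=> e e' _ _ ee'; apply: le_ereal_inf => _ [J [F [EF hF ->]]].
  exists J, F; split=> // i Ji; have [hc hd] := hF i Ji; split=> //.
  by apply: le_trans hd _; rewrite lee_fin.
have /cvg_lim := nonincreasing_at_right_cvge (+oo%O)
  (isT : (BRight (0:R) < +oo)%O) fni.
move=> /(_ (@ereal_hausdorff R)); rewrite -[lim _]/(M_alpha mu alpha E) M0 => sup0.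
have : (f 1%R < eta%:E)%E.
  apply: (@le_lt_trans _ _ 0%E); last by rewrite lte_fin.
  by rewrite sup0; apply: ereal_sup_ubound; exists (1 : R) => //=; rewrite in_itv/= ltr01.
move=> /ereal_inf_lt[_ [J [F [EF hF ->]]] lt]; exists J, F; split=> // i /hF[].
by [].
Qed.

(** For real [sbar], the midpoint between it and [(Pm - t * P) / t]; for [sbar = -oo], any real
    below that quotient. *)
Lemma strict_rate (sbar : \bar R) (t P Pm : R) : 0 < t ->
  (sbar * t%:E < Pm%:E - P%:E * t%:E)%E -> (sbar < +oo)%E ->
  exists2 s, (sbar < s%:E)%E & s * t < Pm - t * P.
Proof.
move=> t0; rewrite -EFinM -EFinB [P * t]mulrC; case: sbar => [r||]//.
  rewrite -EFinM lte_fin => gt _.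
  have rt : r < (Pm - t * P) / t by rewrite ltr_pdivlMr.
  exists (((Pm - t * P) / t + r) / 2); first by rewrite lte_fin; lra.
  by rewrite -ltr_pdivlMr//; lra.
move=> _ _; exists ((Pm - t * P) / t - 1); first by rewrite ltNyr.
by rewrite mulrBl divfK ?gt_eqF// mul1r gtrBl.
Qed.

End Dimension.

Theorem corollary5p1 (R : realType) (I : countType) (A : rel I)
    (A0 : admissible A !=set0)
    (phi : tmc R A0 -> R) (mu : probability (tmc R A0) R)
    (P : R) (K : R^nat) (c : I -> R)
    (N : nat) (Phat : set (tmc R A0)) (l : nat -> nat)
    (w : tmc R A0) (p : nat -> nat) (sbar : \bar R) :
  topologically_mixing R A0 ->
  local_weak_sigma_gibbs phi mu P K c ->
  atomless mu ->
  (nth_variation phi 1 < +oo)%E ->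
  (infinite_set [set: I] ->
     summable_variations phi /\ (gurevich_pressure phi < +oo)%E) ->
  (finite_set [set: I] -> continuous phi) ->
  is_cylinder N Phat ->
  (~ has_ubound (range K) ->
     (limn_esup (fun n => ((l n)%:R / n%:R)%:E : \bar R) < +oo)%E) ->
  hitting_point c w p ->
  sbar = limn_esup (fun n =>
    (n%:R^-1 * ln (fine (mu (cylinder (l n) (tmc_val w))))^-1)%:E) ->
  (sbar < +oo)%E ->
  ((sup [set t : R |
      [/\ 0 < t <= 1,
          (sbar * t%:E <
             gurevich_pressure (fun z => (t * phi z)%R)
               - gurevich_pressure phi * t%:E < +oo)%E &
          exists (m : probability (tmc R A0) R) (Pm : R) (Km : R^nat)
              (cm : I -> R),
            [/\ mixing m,
                local_weak_sigma_gibbs (fun z => (t * phi z)%R) m Pm Km cm,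
                has_ubound (range (fun j => cm (tmc_val w (p j)))) &
                m.-integrable [set: tmc R A0] (EFin \o phi)]]])%:E
    <= Dim mu (W_shift Phat l w))%E.
Proof.
move=> mixA [gib inv] _ _ Iinf Ifin [[x0 Px0] [s0 PE]] lK [pinc hhit] sE sfin.
have cphi : cyl_continuous phi.
  have [fin|inf] := pselect (finite_set [set: I]).
    by apply: continuous_cyl_continuous; exact: Ifin.
  by apply: summable_variations_cyl_continuous; exact: (Iinf inf).1.
have G := local_weak_gibbs_log cphi gib.
have [K1 K0 c1 _] := gib.
rewrite (gurevich_pressureE G mixA inv K1 K0).
have {}PE : Phat = cylinder N (tmc_val x0).
  by rewrite PE; apply: cylinder_mem; rewrite -PE.
set T := [set t : R | _].
(* If [alpha < t], a cover of total weight below [expR T0], with [T0] a budget of [Phat], would miss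
   a point of the set it covers. *)
have dim_ge alpha : 0 <= alpha -> M_alpha mu alpha (W_shift Phat l w) = 0%E ->
    forall t, T t -> t <= alpha.
  move=> alpha0 Malpha t [/andP[t0 t1] /andP[gt _]].
  move=> [m [Pm [Km [cm [mix [gibm invm] hitm _]]]]].
  have Gm := local_weak_gibbs_log (cyl_continuousZ t cphi) gibm.
  have [Km1 Km0 cm1 _] := gibm.
  move: gt; rewrite (gurevich_pressureE Gm mixA invm Km1 Km0) => gt.
  rewrite leNgt; apply/negP => alphat.
  have [s ss st] := strict_rate t0 gt sfin.
  rewrite sE in ss.
  have X01 n : 0 < cylm mu n w <= 1 by rewrite cylm_le1 andbT; case: (G n w).
  have [spos hgood] := good_times K1 K0 lK pinc X01
    (fun a b ab => cylm_le mu w ab) ss.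
  have [C hC] := hitm.
  have hCm j : ln (cm (tmc_val w (p j))) <= ln C.
    have h1 := cm1 (tmc_val w (p j)).
    have h2 : cm (tmc_val w (p j)) <= C by apply: hC; exists j.
    rewrite ler_ln ?posrE//; first exact: lt_le_trans h1.
    exact: lt_le_trans (le_trans h1 h2).
  have D0 : 0 < Pm - t * P by apply: lt_trans st; rewrite mulr_gt0.
  have [T0 hT0] := base_budget G K1 K0 Gm Km1 Km0 t0 t1 w x0 N D0.
  have [J [F [WF Fcyl Flt]]] := small_cover Malpha (expR_gt0 T0).
  have /choice[nF hnF] : forall i, exists n, J i -> is_cylinder n (F i).
    by move=> i; have [/Fcyl[n hn]|Ji] := pselect (J i); [exists n|exists 0%N].
  have FE i : J i -> forall y, F i y -> F i = cylinder (nF i) (tmc_val y).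
    move=> Ji y Fy; have [_ [s' FE]] := hnF i Ji.
    by rewrite FE; apply: cylinder_mem; rewrite -FE.
  (* Since [alpha < t] and measures are at most 1, this weight is at least the measure to the power
     [t]. *)
  pose g i := fine (mu (F i)) `^ alpha.
  have g0 i : 0 <= g i by exact: powR_ge0.
  have gF i : J i -> forall y, F i y -> expR (t * ln (cylm mu (nF i) y)) <= g i.
    move=> Ji y Fy; rewrite /g (FE i Ji y Fy) -/(cylm mu (nF i) y).
    have /andP[X0 X1] : 0 < cylm mu (nF i) y <= 1.
      by rewrite cylm_le1 andbT; case: (G (nF i) y).
    rewrite /powR gt_eqF// ler_expR.
    by apply: ler_wnM2r; [exact: ln_le0|exact: ltW].
  have lT0 : light J F g x0 N T0.
    rewrite /light.
    have S : meeting J F (cylinder N (tmc_val x0)) `<=` J by move=> i [].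
    apply: le_lt_trans (le_esum_subset g S) _; apply: le_lt_trans Flt.
    apply: le_esum => i Ji; have [[y Fy] _] := hnF i Ji.
    by rewrite /g (FE i Ji y Fy) -/(cylm mu (nF i) y) cylmE poweR_EFin.
  have [z Wz zF] := escape G K1 Gm Km1 Km0 t0 t1 FE g0 gF mix spos st hCm hgood
    hT0 lT0.
  rewrite -PE in Wz; by have [i Ji Fz] := WF z Wz; exact: (zF i Ji).
(* For empty [T] the supremum is 0 by convention, and every admissible [alpha] is nonnegative. *)
have [T0|/set0P Tne] := eqVneq T set0.
  by rewrite T0 sup0; apply/ereal_infP => _ [alpha [alpha0 _] <-]; rewrite lee_fin.
apply/ereal_infP => _ [alpha [alpha0 Malpha] <-].
by rewrite lee_fin; apply: ge_sup => //; exact: dim_ge.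
Qed.
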